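(* Let $K$ be a finite (ordered) abstract simplicial complex with topological realization $\|K\|$. Then the simplicial complexity of $K$ equals the (reduced) topological complexity of its realization: $$\mathrm{SC}(K)=\mathrm{TC}(\|K\|).$$
   Context: **Topological complexity.** For a topological space $X$, let $P(X)$ be the space of all continuous paths $\gamma\colon[0,1]\to X$ with the compact-open topology, and let $e\colon P(X)\to X\times X$, $e(\gamma)=(\gamma(0),\gamma(1))$. The reduced topological complexity $\mathrm{TC}(X)$ is one less than the smallest cardinality of open covers $\{U_i\}$ of $X\times X$ such that $e$ admits a continuous section on each $U_i$ (a continuous $\sigma_i\colon U_i\to P(X)$ with $e\circ\sigma_i$ equal to the inclusion $U_i\hookrightarrow X\times X$); it is $\infty$ if no finite such cover exists. **Complexes and products.** ''Complex'' means finite abstract simplicial complex, and $\|K\|$ is its topological realization. Complexes are assumed ordered: the vertices carry a partial order whose restriction to each simplex is total. The product $K\times K$ is the product of ordered complexes: its vertices are pairs $(v,w)$ of vertices of $K$, and its simplices are the sets $\{(v_0,w_0),\dots,(v_n,w_n)\}$ with $v_0\le\cdots\le v_n$, $w_0\le\cdots\le w_n$ and both $\{v_0,\dots,v_n\}$ and $\{w_0,\dots,w_n\}$ simplices of $K$ (repetitions allowed among the $v_i$ and among the $w_i$). The projections induce a homeomorphism $\|K\times K\|\cong\|K\|\times\|K\|$. Maps of complexes are simplicial maps, not required to preserve orderings. **Contiguity.** For an integer $c\ge 0$, two simplicial maps $f,g\colon K\to L$ are $c$-contiguous if there are simplicial maps $h_0,h_1,\dots,h_c\colon K\to L$ with $h_0=f$,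 $h_c=g$ such that for each $i\in\{1,\dots,c\}$ and each simplex $s$ of $K$, $h_{i-1}(s)\cup h_i(s)$ is a simplex of $L$. **Subdivisions and approximations.** $\mathrm{Sd}^b$ denotes the $b$-fold iterated barycentric subdivision ($\mathrm{Sd}^0$ is the identity), and $\|\mathrm{Sd}^b(K\times K)\|$ is identified with $\|K\|\times\|K\|$ in the usual way. A simplicial map $\varphi\colon A\to B$ approximates a continuous map $f\colon\|A\|\to\|B\|$ if, whenever $f(x)$ lies in the closed realization of a simplex $s$ of $B$, so does $\|\varphi\|(x)$. For each $b\ge1$ fix a simplicial map $\iota\colon\mathrm{Sd}^b(K\times K)\to\mathrm{Sd}^{b-1}(K\times K)$ which approximates the identity on $\|K\|\times\|K\|$. For $b\ge0$ and $i\in\{1,2\}$, let $\pi_i\colon\mathrm{Sd}^b(K\times K)\to K$ be the composite of the iterated composition $\iota\colon\mathrm{Sd}^b(K\times K)\to K\times K$ (the identity if $b=0$) with the $i$-th projection $K\times K\to K$. **Simplicial complexity.** For integers $b,c\ge0$, $\mathrm{SC}^b_c(K)$ is one less than the smallest cardinality of finite covers of $\mathrm{Sd}^b(K\times K)$ by subcomplexes $J$ (i.e. $\mathrm{Sd}^b(K\times K)$ is the union of these subcomplexes) for which the restrictions $\pi_1|_J,\pi_2|_J\colon J\to K$ are $c$-contiguous; $\mathrm{SC}^b_c(K)=\infty$ if no such finite cover exists. The sequence $\mathrm{SC}^b_0(K)\ge\mathrm{SC}^b_1(K)\ge\mathrm{SC}^b_2(K)\ge\cdots$ is eventually constant and $\mathrm{SC}^b(K)$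 denotes its stable value (it does not depend on the chosen approximations $\iota$). The sequence $\mathrm{SC}^0(K)\ge\mathrm{SC}^1(K)\ge\mathrm{SC}^2(K)\ge\cdots$ is monotonic and $\mathrm{SC}(K)$, the simplicial complexity of $K$, denotes its stable value. *)

(* Defs.v *)
From HB Require Import structures.
From mathcomp Require Import all_boot all_order all_algebra.
From mathcomp Require Import all_classical all_reals all_analysis.

Set Implicit Arguments.
Unset Strict Implicit.
Unset Printing Implicit Defensive.

Import Order.TTheory GRing.Theory Num.Theory.
Import numFieldNormedType.Exports.

Local Open Scope ring_scope.

(** One less than the least [n] satisfying [P], and [+oo] if there is none.  The
    value [-1] arises only from the empty cover of an empty space or complex. *)
Definition least_minus1 (P : nat -> Prop) : \bar int :=
  if pselect (exists n, `[< P n >]) is left exP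
  then ((ex_minn exP)%:Z - 1)%:E else +oo%E.

(** [+oo] is also the junk value when [u] is not eventually constant. *)
Definition stable_value (u : nat -> \bar int) : \bar int :=
  xget +oo%E [set l | \forall n \near \oo%classic, u n = l]%classic.

Lemma stable_valueP (u : nat -> \bar int) (l : \bar int) :
  (\forall n \near \oo%classic, u n = l) -> stable_value u = l.
Proof.
move=> ul; rewrite /stable_value; case: xgetP => [m _ um|/(_ l)//].
have [n [un um']] : exists n, u n = l /\ u n = m.
  by apply: (@filter_ex _ \oo%classic); exact: (filterI ul um).
by rewrite -un.
Qed.

Record complex := Complex {
  vertex :> finType;
  simplex : {set {set vertex}};
  simplex_neq0 : forall s, s \in simplex -> s != finset.set0;
  simplex_sub : forall s t : {set vertex},
    s \in simplex -> t \subset s -> t != finset.set0 -> t \in simplex;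
  simplex1 : forall v : vertex, [set v] \in simplex }.

Record ordered_complex := OrderedComplex {
  underlying :> complex;
  vle : rel underlying;
  vle_refl : reflexive vle;
  vle_anti : antisymmetric vle;
  vle_trans : transitive vle;
  vle_total : forall s, s \in simplex underlying -> {in s &, total vle} }.

Record smap (K L : complex) := SMap {
  smap_fun :> K -> L;
  smapP : forall s, s \in simplex K -> smap_fun @: s \in simplex L }.

Lemma smap_id_subproof (K : complex) s :
  s \in simplex K -> id @: s \in simplex K.
Proof. by rewrite imset_id. Qed.

Definition smap_id (K : complex) : smap K K := SMap (@smap_id_subproof K).

Lemma smap_comp_subproof (K L M : complex) (g : smap L M) (f : smap K L) s :
  s \in simplex K -> (g \o f) @: s \in simplex M.
Proof. by move=> sK; rewrite imset_comp; do 2 apply: smapP. Qed.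

Definition smap_comp (K L M : complex) (g : smap L M) (f : smap K L) :
  smap K M := SMap (@smap_comp_subproof K L M g f).

(** Only the values [h 0], ..., [h c] matter. *)
Definition contiguous (c : nat) (K L : complex) (f g : smap K L) :=
  exists h : nat -> smap K L,
    [/\ h 0%N =1 f, h c =1 g &
        forall i, (1 <= i <= c)%N -> forall s, s \in simplex K ->
          h i.-1 @: s :|: h i @: s \in simplex L].

Record subcomplex (K : complex) := Subcomplex {
  sub_simplex :> {set {set K}};
  sub_simplexP : sub_simplex \subset simplex K;
  sub_simplex_sub : forall s t : {set K},
    s \in sub_simplex -> t \subset s -> t != finset.set0 ->
    t \in sub_simplex }.

Section Subcomplex.
Variables (K : complex) (J : subcomplex K).

Definition sub_vertex : finType := {v : K | [set v] \in sub_simplex J}.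

Definition sub_faces : {set {set sub_vertex}} :=
  [set s : {set sub_vertex} | val @: s \in sub_simplex J].

Lemma sub_faces_neq0 s : s \in sub_faces -> s != finset.set0.
Proof.
rewrite inE => /(fintype.subsetP (sub_simplexP J))/simplex_neq0.
by apply: contraNneq => ->; rewrite imset0.
Qed.

Lemma sub_faces_sub (s t : {set sub_vertex}) :
  s \in sub_faces -> t \subset s -> t != finset.set0 -> t \in sub_faces.
Proof.
rewrite !inE => sJ ts t0; apply: sub_simplex_sub sJ (imsetS _ ts) _.
by rewrite imset_eq0.
Qed.

Lemma sub_faces1 (v : sub_vertex) : [set v] \in sub_faces.
Proof. by rewrite inE imset_set1 (valP v). Qed.

Definition complex_of_subcomplex : complex :=
  Complex sub_faces_neq0 sub_faces_sub sub_faces1.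

Lemma sub_incl_subproof (s : {set sub_vertex}) :
  s \in sub_faces -> val @: s \in simplex K.
Proof. by rewrite inE => /(fintype.subsetP (sub_simplexP J)). Qed.

Definition sub_incl : smap complex_of_subcomplex K :=
  @SMap complex_of_subcomplex K _ sub_incl_subproof.

Definition restriction (L : complex) (f : smap K L) :
  smap complex_of_subcomplex L := smap_comp f sub_incl.

End Subcomplex.

Section Product.
Variables K L : ordered_complex.

Definition prod_vertex : finType := (K * L)%type.

(** [t] is the list of the pairs [(v_0, w_0)], ..., [(v_n, w_n)]. *)
Definition prod_faces : {set {set prod_vertex}} :=
  [set s : {set prod_vertex} | `[< exists t : seq (K * L),
    [/\ s = [set p in t],
        sorted (@vle K) (unzip1 t), sorted (@vle L) (unzip2 t),
        [set v in unzip1 t] \in simplex K &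
        [set w in unzip2 t] \in simplex L] >]].

Lemma prod_faces_neq0 s : s \in prod_faces -> s != finset.set0.
Proof.
rewrite inE => /asboolP[t [-> _ _ /simplex_neq0/set0Pn[v]]].
rewrite inE => /mapP[p pt _] _; apply/set0Pn; exists p; rewrite inE.
exact: pt.
Qed.

Lemma prod_faces_sub (s r : {set prod_vertex}) :
  s \in prod_faces -> r \subset s -> r != finset.set0 -> r \in prod_faces.
Proof.
rewrite inE => /asboolP[t [-> st1 st2 K1 L2]] rs /set0Pn[p pr].
rewrite inE; apply/asboolP; exists [seq q <- t | q \in r].
have pt : p \in [seq q <- t | q \in r].
  by rewrite mem_filter pr /=; have /fintype.subsetP/(_ _ pr) := rs; rewrite inE.
have sorted_sub (T : finType) (e : rel T) (f : K * L -> T) :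
    transitive e -> sorted e (map f t) ->
    sorted e (map f [seq q <- t | q \in r]).
  by move=> e_tr; apply: subseq_sorted => //; apply/map_subseq/filter_subseq.
have sub_set (T : finType) (f : K * L -> T) :
    [set x in map f [seq q <- t | q \in r]] \subset [set x in map f t].
  apply/fintype.subsetP => x; rewrite !inE => /mapP[q].
  by rewrite mem_filter => /andP[_ qt] ->; apply: map_f.
split.
- apply/setP => q; rewrite inE mem_filter andb_idr // => qr.
  by have /fintype.subsetP/(_ _ qr) := rs; rewrite inE.
- by apply: sorted_sub => //; exact: vle_trans.
- by apply: sorted_sub => //; exact: vle_trans.
- apply: simplex_sub K1 (sub_set _ _) _.
  by apply/set0Pn; exists p.1; rewrite inE map_f.
- apply: simplex_sub L2 (sub_set _ _) _.
  by apply/set0Pn; exists p.2; rewrite inE map_f.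
Qed.

Lemma prod_faces1 (p : prod_vertex) : [set p] \in prod_faces.
Proof.
rewrite inE; apply/asboolP; exists [:: p]; split=> //=.
- by apply/setP => q; rewrite !inE.
- have -> : [set v in [:: p.1]] = [set p.1] by apply/setP => q; rewrite !inE.
  exact: simplex1.
- have -> : [set v in [:: p.2]] = [set p.2] by apply/setP => q; rewrite !inE.
  exact: simplex1.
Qed.

Definition prod_complex : complex :=
  Complex prod_faces_neq0 prod_faces_sub prod_faces1.

Lemma proj1_subproof (s : {set prod_vertex}) :
  s \in prod_faces -> fst @: s \in simplex K.
Proof.
rewrite inE => /asboolP[t [-> _ _ + _]].
suff -> : fst @: [set p in t] = [set v in unzip1 t] by [].
apply/setP => v; rewrite inE.
by apply/imsetP/mapP => -[p pt ->]; exists p; rewrite ?inE// in pt *.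
Qed.

Lemma proj2_subproof (s : {set prod_vertex}) :
  s \in prod_faces -> snd @: s \in simplex L.
Proof.
rewrite inE => /asboolP[t [-> _ _ _]].
suff -> : snd @: [set p in t] = [set v in unzip2 t] by [].
apply/setP => v; rewrite inE.
by apply/imsetP/mapP => -[p pt ->]; exists p; rewrite ?inE// in pt *.
Qed.

Definition sproj1 : smap prod_complex K :=
  @SMap prod_complex K _ proj1_subproof.
Definition sproj2 : smap prod_complex L :=
  @SMap prod_complex L _ proj2_subproof.

End Product.

Section Subdivision.
Variable K : complex.

Definition sd_vertex : finType := {s : {set K} | s \in simplex K}.

Definition sd_faces : {set {set sd_vertex}} :=
  [set c : {set sd_vertex} | (c != finset.set0) &&
    [forall s in c, forall t in c,
      (val s \subset val t) || (val t \subset val s)]].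

Lemma sd_faces_neq0 c : c \in sd_faces -> c != finset.set0.
Proof. by rewrite inE => /andP[]. Qed.

Lemma sd_faces_sub (c d : {set sd_vertex}) :
  c \in sd_faces -> d \subset c -> d != finset.set0 -> d \in sd_faces.
Proof.
rewrite !inE => /andP[_ /forall_inP cP] /fintype.subsetP dc -> /=.
apply/forall_inP => s /dc/cP/forall_inP sP.
by apply/forall_inP => t /dc/sP.
Qed.

Lemma sd_faces1 (s : sd_vertex) : [set s] \in sd_faces.
Proof.
rewrite inE; apply/andP; split; first by apply/set0Pn; exists s; rewrite inE.
apply/forall_inP => t /set1P ->; apply/forall_inP => u /set1P ->.
by rewrite subxx.
Qed.

Definition Sd : complex := Complex sd_faces_neq0 sd_faces_sub sd_faces1.

End Subdivision.

Section Realization.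
Variable R : realType.
Local Open Scope classical_set_scope.

Definition closed_simplex (K : complex) (s : {set K}) (x : K -> R) :=
  forall v, x v != 0 -> v \in s.

Definition barycentric (K : complex) : set {ptws K -> R} :=
  [set x | [/\ forall v, 0 <= x v, \sum_(v : K) x v = 1 &
               exists2 s, s \in simplex K & closed_simplex s x]].

Definition realization (K : complex) : topologicalType :=
  set_type (@barycentric K).

Lemma realization_ge0 (K : complex) (x : realization K) v : 0 <= val x v.
Proof. by have /set_mem[] := valP x. Qed.

Lemma realization_sum (K : complex) (x : realization K) :
  \sum_v val x v = 1.
Proof. by have /set_mem[] := valP x. Qed.

Lemma realization_simplex (K : complex) (x : realization K) :
  exists2 s, s \in simplex K & closed_simplex s (val x).
Proof. by have /set_mem[] := valP x. Qed.

Lemma realize_subproof (K L : complex) (f : smap K L) (x : realization K) :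
  ((fun w => \sum_(v | f v == w) val x v) : {ptws L -> R}) \in @barycentric L.
Proof.
apply/mem_set; split.
- by move=> w; apply: sumr_ge0 => v _; exact: realization_ge0.
- by rewrite -(realization_sum x) [RHS](partition_big f xpredT).
- have [s sK xs] := realization_simplex x.
  exists (imset f (mem s)); first exact: smapP.
  move=> w; apply: contraNT => wfs; rewrite big1 // => v /eqP fv.
  apply/eqP/negPn; apply: contra wfs => /xs vs.
  by rewrite -fv; exact: imset_f.
Qed.

Definition realize (K L : complex) (f : smap K L) (x : realization K) :
  realization L := SigSub (realize_subproof f x).

(** The canonical homeomorphism between [Sd K] and [K]: the affine extension on
    each simplex of the map sending a vertex [s] of [Sd K] to the barycenter of
    the simplex [s] of [K]. *)
Lemma sd_homeo_subproof (K : complex) (x : realization (Sd K)) :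
  ((fun v => \sum_(s : Sd K | v \in val s) val x s / #|val s|%:R)
    : {ptws K -> R}) \in @barycentric K.
Proof.
apply/mem_set; split.
- move=> v; apply: sumr_ge0 => s _.
  by rewrite divr_ge0 ?ler0n// realization_ge0.
- rewrite (exchange_big_dep xpredT)//= -[RHS](realization_sum x).
  apply: eq_bigr => s _; rewrite sumr_const -[LHS]mulr_natr; apply: divfK.
  by rewrite pnatr_eq0 cards_eq0 simplex_neq0// (valP s).
- have [c cK xc] := realization_simplex x.
  move: (cK); rewrite inE => /andP[/set0Pn[s0 s0c] /forall_inP cP].
  have [m mc mmax] := @arg_maxnP _ s0 (mem c) (fun s => #|val s|) s0c.
  exists (val m); first exact: valP.
  move=> v; apply: contraNT => vm; rewrite big1 // => s vs.
  have [->|/xc sc] := eqVneq (val x s) 0; first by rewrite mul0r.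
  have /forall_inP/(_ _ mc)/orP[/fintype.subsetP/(_ _ vs)|ms] := cP _ sc.
    by rewrite (negPf vm).
  have /eqP ms' : val m == val s by rewrite eqEcard ms; exact: mmax.
  by rewrite ms' vs in vm.
Qed.

Definition sd_homeo (K : complex) (x : realization (Sd K)) : realization K :=
  SigSub (sd_homeo_subproof x).

Definition approximates (K L : complex) (phi : smap K L)
    (f : realization K -> realization L) :=
  forall (x : realization K) s, s \in simplex L ->
    closed_simplex s (val (f x)) -> closed_simplex s (val (realize phi x)).

End Realization.

Section SimplicialComplexity.
Variable K : ordered_complex.

Definition SdP (b : nat) : complex := iter b Sd (prod_complex K K).

(** The usual identification of the realization of [SdP b] with the square of the
    realization of [K] is the composite of the homeomorphisms [sd_homeo] and of
    the one given by the two projections; through it, the identity becomes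
    [sd_homeo : realization (SdP b.+1) -> realization (SdP b)], which is what
    [iota b] is to approximate. *)
Variable iota : forall b, smap (SdP b.+1) (SdP b).

Fixpoint iota_iter (b : nat) : smap (SdP b) (prod_complex K K) :=
  if b is b'.+1 then smap_comp (iota_iter b') (iota b')
  else smap_id (prod_complex K K).

Definition pi1 (b : nat) : smap (SdP b) K :=
  smap_comp (sproj1 K K) (iota_iter b).
Definition pi2 (b : nat) : smap (SdP b) K :=
  smap_comp (sproj2 K K) (iota_iter b).

Definition SC_cover (b c n : nat) :=
  exists J : 'I_n -> subcomplex (SdP b),
    (forall s, s \in simplex (SdP b) -> exists i, s \in sub_simplex (J i)) /\
    (forall i, contiguous c (restriction (J i) (pi1 b))
                            (restriction (J i) (pi2 b))).

Definition SCbc (b c : nat) : \bar int := least_minus1 (SC_cover b c).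
Definition SCb (b : nat) : \bar int := stable_value (SCbc b).
Definition SC : \bar int := stable_value SCb.

End SimplicialComplexity.

Section TopologicalComplexity.
Variables (R : realType) (X : topologicalType).
Local Open Scope classical_set_scope.

Definition unit_interval : topologicalType := set_type `[0 : R, 1].

Lemma unit_interval0 : (0 : R) \in `[0 : R, 1].
Proof. by apply/mem_set; rewrite /= in_itv /= lexx ler01. Qed.

Lemma unit_interval1 : (1 : R) \in `[0 : R, 1].
Proof. by apply/mem_set; rewrite /= in_itv /= lexx ler01. Qed.

Definition path_space : Type := continuousType unit_interval X.

(** The library equips [continuousType] with this topology only where
    [ArrowAsCompactOpen] is imported. *)
HB.instance Definition _ := Choice.on path_space.
HB.instance Definition _ := Topological.copy path_space
  (@initial_topology path_space {compact-open, unit_interval -> X}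
     (fun g => g : unit_interval -> X)).

Definition path_ends (g : path_space) : X * X :=
  ((g : unit_interval -> X) (SigSub unit_interval0),
   (g : unit_interval -> X) (SigSub unit_interval1)).

Definition TC_cover (n : nat) :=
  exists U : 'I_n -> set (X * X),
    [/\ forall i, open (U i),
        \bigcup_i U i = setT &
        forall i, exists sigma : set_type (U i) -> path_space,
          continuous sigma /\ forall u, path_ends (sigma u) = val u].

Definition TC : \bar int := least_minus1 TC_cover.

End TopologicalComplexity.

(* Main.v *)
(** Both inequalities are proved with explicit maps, and without simplicial
    approximation theory.  The only property of [iota] that matters is that it
    sends a face [F], seen as a vertex of the subdivision, to a vertex of [F].

    SC >= TC: there is a continuous map [g] from the square of [|K|] to
    [|SdP b|] which is only an approximate inverse of the canonical
    homeomorphism, but good enough for [|pi_i| (g z)] to lie in the closed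
    simplex carrying the [i]-th component of [z].  A subcomplex [J] retracts, up
    to linear homotopies, a neighborhood onto itself: write a point in the
    barycentric subdivision and drop the faces outside [J].  Over the
    neighborhood a motion plan is the concatenation of linear homotopies
    [z.1 ~ |pi1| ~ ... ~ |pi2| ~ z.2], the middle ones given by the contiguity.

    TC >= SC: for [b] large, the vertices of each simplex of [SdP b] lie, as
    points of the square of [|K|], in one open set [U_i] where the motion plan
    [sigma_i] varies little (Lebesgue number).  At finitely many times [t_k], send
    a vertex [p] to a vertex of [K] where the barycentric coordinates of
    [sigma_i p t_k] are maximal: such vertices belong to the support of every
    point of [|K|] close enough, so that these simplicial maps are consecutively
    contiguous, from [pi1] to [pi2]. *)

Require Import Defs.
From HB Require Import structures.
From mathcomp Require Import all_boot all_order all_algebra.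
From mathcomp Require Import all_classical all_reals all_analysis.
From mathcomp Require Import lra zify.

Set Implicit Arguments.
Unset Strict Implicit.
Unset Printing Implicit Defensive.

Import Order.TTheory GRing.Theory Num.Theory.
Import numFieldNormedType.Exports.

Local Open Scope ring_scope.

(** * Realizations *)

Section RealizationTopology.
Variable R : realType.
Implicit Types K L : complex.

Lemma continuous_sum (T : topologicalType) (I : Type) (r : seq I) (P : pred I)
    (f : I -> T -> R) :
  (forall i, P i -> continuous (f i)) ->
  continuous (fun x => \sum_(i <- r | P i) f i x).
Proof. by apply: continuous_big; exact: add_continuous. Qed.

Lemma continuous_prod (T : topologicalType) (I : Type) (r : seq I) (P : pred I)
    (f : I -> T -> R) :
  (forall i, P i -> continuous (f i)) ->
  continuous (fun x => \prod_(i <- r | P i) f i x).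
Proof. by apply: continuous_big; exact: mul_continuous. Qed.

Lemma continuous_add (T : topologicalType) (f g : T -> R) :
  continuous f -> continuous g -> continuous (fun t => f t + g t).
Proof. by move=> fc gc t; apply: cvgD; [exact: fc|exact: gc]. Qed.

Lemma continuous_mul (T : topologicalType) (f g : T -> R) :
  continuous f -> continuous g -> continuous (fun t => f t * g t).
Proof. by move=> fc gc t; apply: cvgM; [exact: fc|exact: gc]. Qed.

Lemma coord_continuous K v :
  continuous (fun x : realization R K => val x v : R).
Proof.
move=> x; apply: (@continuous_comp (realization R K) {ptws K -> R} R
  (@set_val _ (@barycentric R K)) (fun g => g v)).
  exact: initial_continuous.
exact: (@proj_continuous K (fun=> R) v).
Qed.

Lemma continuous_coord (T : topologicalType) K (f : T -> realization R K) :
  (forall v, continuous (fun t => val (f t) v : R)) -> continuous f.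
Proof.
move=> fc; apply: continuous_comp_initial => t.
apply/cvg_sup => v.
exact: (@continuous_comp_initial _ T R (fun g : K -> R => g v)
  (fun t => val (f t)) (fc v)).
Qed.

Definition supp K (x : realization R K) : {set K} := [set v | val x v != 0].

Lemma in_supp K (x : realization R K) v : (v \in supp x) = (val x v != 0).
Proof. by rewrite inE. Qed.

Lemma supp_sub_simplex K (x : realization R K) s :
  closed_simplex s (val x) -> supp x \subset s.
Proof. by move=> xs; apply/fintype.subsetP => v; rewrite inE; exact: xs. Qed.

Lemma supp_simplex K (x : realization R K) : supp x \in simplex K.
Proof.
have [s sK xs] := realization_simplex x.
apply: simplex_sub sK (supp_sub_simplex xs) _.
apply: contraNneq (oner_neq0 R) => x0.
apply/eqP; rewrite -(realization_sum x) big1// => v _.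
by apply/eqP; move/setP/(_ v): x0; rewrite !inE => /negbFE.
Qed.

Lemma sum_coord_neq0 K (x : realization R K) (P : pred K) :
  (\sum_(v | P v) val x v != 0) = [exists v, P v && (v \in supp x)].
Proof.
rewrite psumr_neq0; last by move=> v _; exact: realization_ge0.
have xE v : (0 < val x v) = (v \in supp x).
  by rewrite lt_neqAle realization_ge0 eq_sym andbT in_supp.
apply/hasP/existsP => [[v _]|[v]]; rewrite -?xE; first by exists v; rewrite -xE.
by exists v; rewrite ?mem_index_enum.
Qed.

Lemma supp_realize K L (f : smap K L) (x : realization R K) :
  supp (realize f x) = f @: supp x.
Proof.
apply/setP => w; rewrite in_supp /= sum_coord_neq0.
apply/existsP/imsetP => [[v /andP[/eqP <- xv]]|[v xv ->]]; first by exists v.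
by exists v; rewrite eqxx.
Qed.

Lemma realize_continuous K L (f : smap K L) :
  continuous (@realize R K L f).
Proof.
apply: continuous_coord => w.
by apply: continuous_sum => v _; exact: coord_continuous.
Qed.

Section Normalize.
Variables (T : topologicalType) (L : complex) (w : T -> L -> R).
Hypothesis w_cont : forall p, continuous (w ^~ p).
Hypothesis w_ge0 : forall t p, 0 <= w t p.
Hypothesis w_simplex : forall t,
  exists2 s, s \in simplex L & closed_simplex s (w t).
Hypothesis w_neq0 : forall t, exists p, w t p != 0.

Let total t := \sum_p w t p.

Let total_gt0 t : 0 < total t.
Proof.
have [p wp] := w_neq0 t; rewrite /total (bigD1 p)//= ltr_pwDl//.
  by rewrite lt_neqAle eq_sym wp w_ge0.
exact: sumr_ge0.
Qed.

(** Dividing by the total weight does not change which weights vanish. Continuous maps into a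
    realization can therefore be specified by unnormalized weights, with full control of
    supports. *)
Lemma normalize : exists g : T -> realization R L, continuous g /\
  forall t, supp (g t) = [set p | w t p != 0].
Proof.
have gP t : (fun p => w t p / total t : R) \in @barycentric R L.
  apply/mem_set; split.
  - by move=> p; rewrite divr_ge0// ltW.
  - by rewrite -mulr_suml -/(total t) divff// gt_eqF.
  - have [s sL ws] := w_simplex t; exists s => // p.
    by rewrite mulf_eq0 negb_or => /andP[+ _]; exact: ws.
exists (fun t => SigSub (gP t)); split.
  apply: continuous_coord => p t /=; apply: cvgM; first exact: w_cont.
  apply: cvgV; first by rewrite gt_eqF.
  by apply: continuous_sum => q _; exact: w_cont.
move=> t; apply/setP => p; rewrite !inE /= mulf_eq0 negb_or invr_eq0.
by rewrite (gt_eqF (total_gt0 t)) andbT.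
Qed.

End Normalize.

End RealizationTopology.

(** * Homotopies *)

Section Homotopy.
Variable R : realType.
Implicit Types (T : topologicalType) (K L : complex).

Lemma continuous_pair (T U V : topologicalType) (f : T -> U) (g : T -> V) :
  continuous f -> continuous g -> continuous (fun x => (f x, g x)).
Proof. by move=> fc gc x; apply: cvg_pair; [exact: fc|exact: gc]. Qed.

(** The retraction of [R] onto [[0, 1]]. *)
Definition clamp (t : R) : R := (1 + `|t| - `|t - 1|) / 2.

Lemma clamp_continuous : continuous clamp.
Proof.
move=> t; apply: cvgM; last exact: cvg_cst.
apply: cvgB; first by apply: cvgD; [exact: cvg_cst|exact: cvg_norm].
by apply: cvg_norm; apply: cvgB; [exact: cvg_id|exact: cvg_cst].
Qed.

Lemma clamp_le0 t : t <= 0 -> clamp t = 0.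
Proof. by rewrite /clamp => t0; rewrite ler0_norm// ler0_norm; lra. Qed.

Lemma clamp_ge1 t : 1 <= t -> clamp t = 1.
Proof. by rewrite /clamp => t1; rewrite ger0_norm ?ger0_norm; lra. Qed.

Lemma clamp01 t : 0 <= clamp t <= 1.
Proof.
have [t0|t0] := leP t 0; first by rewrite clamp_le0// lexx ler01.
have [t1|t1] := leP 1 t; first by rewrite clamp_ge1// lexx ler01.
by rewrite /clamp gtr0_norm// ltr0_norm; lra.
Qed.

(** Time ranges over all of [R]: gluing is then done with [clamp]. *)
Definition homotopic T K (f g : T -> realization R K) :=
  exists H : T * R -> realization R K,
    [/\ continuous H, forall u, H (u, 0) = f u & forall u, H (u, 1) = g u].

Lemma homotopic_trans T K (f g h : T -> realization R K) :
  homotopic f g -> homotopic g h -> homotopic f h.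
Proof.
move=> [H1 [H1c H10 H11]] [H2 [H2c H20 H21]].
(* At each time one of the first two terms cancels the common endpoint, so that no
   pasting lemma is needed. *)
pose G (x : T * R) (v : K) : R := val (H1 (x.1, clamp (2 * x.2))) v +
  val (H2 (x.1, clamp (2 * x.2 - 1))) v - val (H1 (x.1, 1)) v.
have GP x : G x = val (if x.2 <= 1 / 2 then H1 (x.1, clamp (2 * x.2))
                       else H2 (x.1, clamp (2 * x.2 - 1))).
  apply/funext => v; rewrite /G H11; case: ifPn => x2.
    by rewrite (@clamp_le0 (2 * x.2 - 1)) ?H20 ?addrK//; lra.
  by rewrite (@clamp_ge1 (2 * x.2)) ?H11 1?addrC ?addKr//; lra.
have GB x : (G x : {ptws K -> R}) \in @barycentric R K by rewrite GP; exact: valP.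
exists (fun x => SigSub (GB x)); split.
- have c2 (a : R) : continuous (fun x : T * R => clamp (2 * x.2 - a)).
    move=> x; apply: (@continuous_comp _ _ _ (fun x : T * R => 2 * x.2 - a)).
      apply: cvgB; last exact: cvg_cst.
      by apply: cvgM; [exact: cvg_cst|exact: cvg_snd].
    exact: clamp_continuous.
  have cH (H : T * R -> realization R K) (c : T * R -> R) v : continuous H ->
      continuous c -> continuous (fun x => val (H (x.1, c x)) v : R).
    move=> Hc cc x.
    apply: (@continuous_comp _ _ _ (fun x : T * R => H (x.1, c x))
      (fun y => val y v : R)); last exact: coord_continuous.
    apply: (@continuous_comp _ _ _ (fun x : T * R => (x.1, c x)) H).
      by apply: continuous_pair => // y; exact: cvg_fst.
    exact: Hc.
  apply: continuous_coord => v x /=; apply: cvgB.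
    apply: cvgD; last by apply: cH.
    have := cH H1 _ v H1c (c2 0) x; rewrite /continuous_at.
    by under eq_fun do rewrite subr0; rewrite subr0.
  by apply: (cH H1 (fun=> 1)) => //; exact: cst_continuous.
- move=> u; apply/val_inj => /=; rewrite GP /= -H10 ifT; last by lra.
  by rewrite mulr0 clamp_le0.
- move=> u; apply/val_inj => /=; rewrite GP /= -H21 ifF; last by lra.
  by rewrite mulr1 clamp_ge1//; lra.
Qed.

(** The segment from [f t] to [g t] stays in the simplex spanned by both supports, so the linear
    homotopy never leaves the realization. *)
Lemma homotopic_supp T K (f g : T -> realization R K) :
  continuous f -> continuous g ->
  (forall t, supp (f t) :|: supp (g t) \in simplex K) -> homotopic f g.
Proof.
move=> fc gc fg.
pose G (x : T * R) (v : K) : R :=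
  (1 - clamp x.2) * val (f x.1) v + clamp x.2 * val (g x.1) v.
have GB x : (G x : {ptws K -> R}) \in @barycentric R K.
  have /andP[c0 c1] := clamp01 x.2.
  apply/mem_set; split.
  - move=> v; rewrite /G addr_ge0// mulr_ge0// ?realization_ge0//.
    by rewrite subr_ge0.
  - rewrite big_split/= -!mulr_sumr !realization_sum; lra.
  - exists (supp (f x.1) :|: supp (g x.1)) => // v; rewrite !inE /G.
    apply: contraR; rewrite negb_or !negbK => /andP[/eqP -> /eqP ->].
    by rewrite !mulr0 addr0.
exists (fun x => SigSub (GB x)); split.
- have cx : continuous (fun x : T * R => clamp x.2).
    move=> x; apply: (@continuous_comp _ _ _ snd clamp); first exact: cvg_snd.
    exact: clamp_continuous.
  have fx (h : T -> realization R K) v : continuous h ->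
      continuous (fun x : T * R => val (h x.1) v : R).
    move=> hc x; apply: (@continuous_comp _ _ _ (fun x : T * R => h x.1)
      (fun y => val y v : R)); last exact: coord_continuous.
    by apply: (@continuous_comp _ _ _ fst h); [exact: cvg_fst|exact: hc].
  apply: continuous_coord => v x /=; apply: cvgD.
    apply: cvgM; last exact: fx.
    by apply: cvgB; [exact: cvg_cst|exact: cx].
  by apply: cvgM; [exact: cx|exact: fx].
- move=> u; apply/val_inj/funext => v /=.
  by rewrite /G /= clamp_le0// subr0 mul0r addr0 mul1r.
- move=> u; apply/val_inj/funext => v /=.
  by rewrite /G /= clamp_ge1// subrr mul0r add0r mul1r.
Qed.

(** Currying turns a homotopy into a map to paths that is continuous for the compact-open topology;
    this is how motion plans arise below. *)
Lemma homotopic_section T K (f g : T -> realization R K) :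
  homotopic f g ->
  exists sigma : T -> path_space R (realization R K),
    continuous sigma /\ forall u, path_ends (sigma u) = (f u, g u).
Proof.
move=> [H [Hc H0 H1]].
pose I := unit_interval R.
pose G (x : T * I) := H (x.1, val x.2).
have Gc : continuous G.
  move=> x; apply: (@continuous_comp _ _ _ (fun x : T * I => (x.1, val x.2)) H).
    apply: continuous_pair; first by move=> y; exact: cvg_fst.
    move=> y; apply: (@continuous_comp _ _ _ snd (@set_val _ `[0 : R, 1]%classic)).
      exact: cvg_snd.
    exact: initial_continuous.
  exact: Hc.
have [cG cGu] := continuous_curry Gc.
have sigP u : continuous (curry G u : I -> realization R K) by exact: cGu.
pose sigma u : path_space R (realization R K) :=
  HB.pack_for (continuousType I (realization R K)) (curry G u)
    (isContinuous.Build _ _ _ (sigP u)).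
exists sigma; split; last first.
  by move=> u; congr pair; rewrite /= /curry /G /= ?H0 ?H1.
apply: continuous_comp_initial.
exact: cG.
Qed.

End Homotopy.

(** * Approximate inverses *)

Section ApproximateInverses.
Variable R : realType.
Implicit Types K L : complex.

(** Twice the positive part. *)
Definition pos (r : R) : R := r + `|r|.

Lemma pos_ge0 r : 0 <= pos r.
Proof. by rewrite /pos -lerBlDl sub0r ler_normr lexx orbT. Qed.

Lemma pos_neq0 r : (pos r != 0) = (0 < r).
Proof.
rewrite /pos; have [r0|r0] := leP r 0; first by rewrite ler0_norm// subrr eqxx.
by rewrite gtr0_norm// gt_eqF// addr_gt0.
Qed.

Lemma continuous_pos (T : topologicalType) (f g : T -> R) :
  continuous f -> continuous g -> continuous (fun t => pos (f t - g t)).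
Proof.
move=> fc gc t; apply: cvgD; first by apply: cvgB; [exact: fc|exact: gc].
by apply: cvg_norm; apply: cvgB; [exact: fc|exact: gc].
Qed.

Lemma vertex_point_subproof K (v : K) :
  ((fun w => (w == v)%:R : R) : {ptws K -> R}) \in @barycentric R K.
Proof.
apply/mem_set; split.
- by move=> w; rewrite ler0n.
- by rewrite (bigD1 v)//= eqxx big1 ?addr0// => w /negPf ->.
- exists [set v]; first exact: simplex1.
  by move=> w; rewrite inE pnatr_eq0 eqb0 negbK.
Qed.

Definition vertex_point K (v : K) : realization R K :=
  SigSub (vertex_point_subproof v).

Lemma supp_vertex_point K (v : K) : supp (vertex_point v) = [set v].
Proof. by apply/setP => w; rewrite !inE /= pnatr_eq0 eqb0 negbK. Qed.

(** At the vertex [F], the canonical homeomorphism takes the barycenter of [F] as its value, which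
    lies in the closed simplex [F]; the approximation must keep [phi F] there. *)
Lemma approximates_sd_homeo K (phi : smap (Sd K) K) :
  approximates phi (@sd_homeo R K) -> forall F : Sd K, phi F \in val F.
Proof.
move=> phi_approx F.
apply: (phi_approx (vertex_point F) (val F) (valP F)).
  move=> v /=; apply: contraR => vF; rewrite big1// => s vs.
  by rewrite [s == F]negbTE ?mul0r//; apply: contraNneq vF => <-.
by rewrite -in_supp supp_realize supp_vertex_point imset_set1 inE.
Qed.

(** * Approximate inverse for one barycentric subdivision *)

Section SdInverse.
Variable K : complex.

(** Positive exactly when [F] is a superlevel set of [x] inside its support; such
    sets form a chain. *)
Definition sd_weight (x : realization R K) (F : Sd K) : R :=
  \prod_(p in val F) (val x p *
    \prod_(q | q \notin val F) pos (val x p - val x q)).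

Lemma sd_weight_neq0 x F : sd_weight x F != 0 ->
  {in val F, forall p, p \in supp x /\
     forall q, q \notin val F -> val x q < val x p}.
Proof.
move=> /prodf_neq0 wF p /wF; rewrite mulf_eq0 negb_or => /andP[xp].
move=> /prodf_neq0 xq; split; first by rewrite inE.
by move=> q /xq; rewrite pos_neq0 subr_gt0.
Qed.

Lemma sd_inverse : exists g : realization R K -> realization R (Sd K),
  continuous g /\ forall x F, F \in supp (g x) -> val F \subset supp x.
Proof.
have wc F : continuous (sd_weight ^~ F).
  apply: continuous_prod => p _.
  apply: continuous_mul; first exact: coord_continuous.
  apply: continuous_prod => q _.
  by apply: continuous_pos; exact: coord_continuous.
have w0 x F : 0 <= sd_weight x F.
  apply: prodr_ge0 => p _; rewrite mulr_ge0 ?realization_ge0//.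
  by apply: prodr_ge0 => q _; exact: pos_ge0.
(* The set of vertices where [x] attains its maximum is a face of nonzero weight. *)
have wneq0 x : exists F, sd_weight x F != 0.
  have [v0 xv0] := set0Pn _ (simplex_neq0 (supp_simplex x)).
  have [m _ mmax] := @Order.TotalTheory.arg_maxP _ _ _ v0 xpredT (val x) isT.
  have xm : 0 < val x m.
    apply: lt_le_trans (mmax v0 isT).
    by rewrite lt_neqAle realization_ge0 eq_sym andbT; rewrite inE in xv0.
  have sF : [set p | val x p == val x m] \in simplex K.
    apply: simplex_sub (supp_simplex x) _ _.
      by apply/fintype.subsetP => p; rewrite !inE => /eqP ->; rewrite gt_eqF.
    by apply/set0Pn; exists m; rewrite inE.
  exists (@exist _ (fun s => s \in simplex K) _ sF).
  apply/prodf_neq0 => p /=; rewrite inE => /eqP ->.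
  rewrite mulf_neq0 ?(gt_eqF xm)//; apply/prodf_neq0 => q; rewrite inE => xq.
  by rewrite pos_neq0 subr_gt0 lt_neqAle xq; exact: mmax.
have wsimplex x : exists2 s, s \in simplex (Sd K) & closed_simplex s (sd_weight x).
  exists [set F | sd_weight x F != 0]; last by move=> F; rewrite inE.
  rewrite inE; apply/andP; split.
    by have [F wF] := wneq0 x; apply/set0Pn; exists F; rewrite inE.
  apply/forall_inP => F; rewrite inE => /sd_weight_neq0 wF.
  apply/forall_inP => G; rewrite inE => /sd_weight_neq0 wG.
  (* Were [p] in [F] outside [G] and [q] in [G] outside [F], then [x] would be strictly larger at
     [p] than at [q] and conversely. *)
  case: (boolP (val F \subset val G)) => //= /subsetPn[p pF pG].
  apply/fintype.subsetP => q qG; apply: contraT => qF.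
  have [_ /(_ _ qF) xqp] := wF p pF; have [_ /(_ _ pG)] := wG q qG.
  by rewrite ltNge (ltW xqp).
have [g [gc gs]] := normalize wc w0 wsimplex wneq0.
exists g; split=> // x F; rewrite gs inE => /sd_weight_neq0 wF.
by apply/fintype.subsetP => p /wF[].
Qed.

End SdInverse.

(** * Approximate inverse for the product *)

Section ProductInverse.

(** For [v] in the support of [x], a chain for [vle], this is the left end of the interval of length
    [val x v] assigned to [v]. *)
Definition below (K : ordered_complex) (x : realization R K) (v : K) : R :=
  \sum_(u | vle u v && (u != v)) val x u.

Lemma belowD (K : ordered_complex) (x : realization R K) (u v : K) :
  vle u v -> u != v -> below x u + val x u <= below x v.
Proof.
move=> uv nuv; rewrite /below [leRHS](bigD1 u) ?uv ?nuv//= addrC lerD2r.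
rewrite big_mkcond [leRHS]big_mkcond; apply: ler_sum => w _.
case: ifPn => [/andP[wu nwu]|_]; last by case: ifP; rewrite ?realization_ge0.
rewrite nwu andbT (vle_trans wu uv) ifT//=; apply: contraNneq nuv => wv.
by apply/eqP/(@vle_anti K); rewrite uv -wv.
Qed.

(** A support vertex minimizing [below] is the first one: by [belowD], a support vertex strictly
    under it would have a smaller value. *)
Lemma below_eq0 (K : ordered_complex) (x : realization R K) :
  exists2 v, v \in supp x & below x v = 0.
Proof.
have [v0 xv0] := set0Pn _ (simplex_neq0 (supp_simplex x)).
have [m xm mmin] := @Order.TotalTheory.arg_minP _ _ _ v0
  (mem (supp x)) (below x) xv0.
exists m => //; rewrite /below big1// => u /andP[um num].
apply/eqP; apply: contraT => xu.
have := belowD x um num; have /mmin : u \in supp x by rewrite inE.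
have : 0 < val x u by rewrite lt_neqAle realization_ge0 eq_sym xu.
lra.
Qed.

Variables K L : ordered_complex.

(** Lay the coordinates of each factor end to end along the order of its vertices:
    the weight of a pair is positive exactly when its two intervals overlap. *)
Definition prod_weight (z : realization R K * realization R L)
    (p : prod_complex K L) : R :=
  val z.1 p.1 * val z.2 p.2 *
  pos (below z.1 p.1 + val z.1 p.1 - below z.2 p.2) *
  pos (below z.2 p.2 + val z.2 p.2 - below z.1 p.1).

Lemma prod_weight_neq0 z p : (prod_weight z p != 0) =
  [&& p.1 \in supp z.1, p.2 \in supp z.2,
      below z.2 p.2 < below z.1 p.1 + val z.1 p.1 &
      below z.1 p.1 < below z.2 p.2 + val z.2 p.2].
Proof.
by rewrite /prod_weight !mulf_eq0 !negb_or !pos_neq0 !subr_gt0 -!andbA !inE.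
Qed.

Let ple : rel (K * L) := fun p q => vle p.1 q.1 && vle p.2 q.2.

(** If [p.1 < q.1] but [q.2 < p.2], the overlaps are contradictory: the interval of [p.2] starts
    before that of [p.1] ends, so before that of [q.1] starts, so before that of [q.2] ends, which
    is at most where that of [p.2] starts. *)
Lemma prod_weight_total z (p q : prod_complex K L) :
  prod_weight z p != 0 -> prod_weight z q != 0 -> ple p q || ple q p.
Proof.
wlog pq1 : p q / vle p.1 q.1 => [wl wp wq|].
  have [p1 q1] : p.1 \in supp z.1 /\ q.1 \in supp z.1.
    by move: wp wq; rewrite !prod_weight_neq0 => /and4P[-> _ _ _] /and4P[-> _ _ _].
  have /orP[|] := vle_total (supp_simplex z.1) p1 q1; first by move/wl; apply.
  by rewrite orbC => /wl; apply.
rewrite !prod_weight_neq0 => /and4P[p1 p2 pl pr] /and4P[q1 q2 ql qr].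
rewrite /ple pq1 /=; have /orP[->//|qp2] := vle_total (supp_simplex z.2) p2 q2.
have [->|npq1] := eqVneq p.1 q.1; first by rewrite qp2 vle_refl orbT.
have [->|nqp2] := eqVneq q.2 p.2; first by rewrite vle_refl.
have := belowD z.1 pq1 npq1; have := belowD z.2 qp2 nqp2.
lra.
Qed.

Lemma prod_inverse :
  exists g : realization R K * realization R L -> realization R (prod_complex K L),
  continuous g /\ forall z p, p \in supp (g z) ->
    p.1 \in supp z.1 /\ p.2 \in supp z.2.
Proof.
have wc p : continuous (prod_weight ^~ p).
  have c1 v :
      continuous (fun z : realization R K * realization R L => val z.1 v : R).
    move=> z; apply: (@continuous_comp _ _ _ fst
      (fun x : realization R K => val x v : R)); first exact: cvg_fst.
    exact: coord_continuous.
  have c2 v :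
      continuous (fun z : realization R K * realization R L => val z.2 v : R).
    move=> z; apply: (@continuous_comp _ _ _ snd
      (fun x : realization R L => val x v : R)); first exact: cvg_snd.
    exact: coord_continuous.
  have b1 v : continuous (fun z : realization R K * realization R L => below z.1 v).
    by apply: continuous_sum => u _; exact: c1.
  have b2 v : continuous (fun z : realization R K * realization R L => below z.2 v).
    by apply: continuous_sum => u _; exact: c2.
  apply: continuous_mul; first apply: continuous_mul.
  - by apply: continuous_mul; [exact: c1|exact: c2].
  - apply: continuous_pos; last exact: b2.
    by apply: continuous_add; [exact: b1|exact: c1].
  - apply: continuous_pos; last exact: b1.
    by apply: continuous_add; [exact: b2|exact: c2].
have w0 z p : 0 <= prod_weight z p.
  by rewrite /prod_weight !mulr_ge0 ?realization_ge0 ?pos_ge0.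
(* The first intervals of the two factors both start at 0, so they overlap. *)
have wneq0 z : exists p, prod_weight z p != 0.
  have [v zv bv] := below_eq0 z.1; have [w zw bw] := below_eq0 z.2.
  exists (v, w); rewrite prod_weight_neq0 /= zv zw bv bw !add0r.
  rewrite inE in zv; rewrite inE in zw.
  by rewrite !lt_neqAle !realization_ge0 ![0 == _]eq_sym zv zw.
have wsimplex z :
    exists2 s, s \in simplex (prod_complex K L) & closed_simplex s (prod_weight z).
  pose S : {set prod_complex K L} := [set p | prod_weight z p != 0].
  have [p0 wp0] := wneq0 z.
  exists S; last by move=> p; rewrite inE.
  (* The pairs of nonzero weight are totally ordered by [ple]; sorting them yields the list that
     [prod_faces] asks for. *)
  pose t := path.sort ple (enum S).
  have tS : t =i S by move=> p; rewrite mem_sort mem_enum.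
  have ts : sorted ple t.
    apply: (@sort_sorted_in _ (mem S)); last by apply/allP => p; rewrite mem_enum.
    move=> p q pS qS; apply: (@prod_weight_total z).
      by move: pS; rewrite inE.
    by move: qS; rewrite inE.
  rewrite inE; apply/asboolP; exists t; split.
  - by apply/setP => p; rewrite [RHS]inE tS.
  - by rewrite sorted_map; apply: sub_sorted ts => p q /andP[].
  - by rewrite sorted_map; apply: sub_sorted ts => p q /andP[].
  - apply: simplex_sub (supp_simplex z.1) _ _.
      apply/fintype.subsetP => v; rewrite inE => /mapP[p + ->].
      by rewrite tS inE prod_weight_neq0 => /and4P[].
    by apply/set0Pn; exists p0.1; rewrite inE map_f// tS inE.
  - apply: simplex_sub (supp_simplex z.2) _ _.
      apply/fintype.subsetP => v; rewrite inE => /mapP[p + ->].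
      by rewrite tS inE prod_weight_neq0 => /and4P[].
    by apply/set0Pn; exists p0.2; rewrite inE map_f// tS inE.
have [g [gc gs]] := normalize wc w0 wsimplex wneq0.
by exists g; split=> // z p; rewrite gs inE prod_weight_neq0 => /and4P[].
Qed.

End ProductInverse.

End ApproximateInverses.

(** * From contiguity to motion planning *)

Lemma sd_chain_max (L : complex) (c : {set Sd L}) :
  c \in simplex (Sd L) ->
  exists2 M, M \in c & forall F, F \in c -> val F \subset val M.
Proof.
rewrite inE => /andP[/set0Pn[s0 s0c] /forall_inP cP].
have [M Mc Mmax] := @arg_maxnP _ s0 (mem c) (fun F => #|val F|) s0c.
exists M => // F Fc; have /forall_inP/(_ _ Mc)/orP[//|MF] := cP _ Fc.
suff /eqP -> : val M == val F by [].
by rewrite eqEcard MF; exact: Mmax.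
Qed.

Section FromSimplicial.
Variable R : realType.

Section SubcomplexNeighborhood.
Variables (L : complex) (J : subcomplex L) (T : topologicalType).
Variable f : T -> realization R (Sd L).
Hypothesis f_cont : continuous f.
Hypothesis f_meets : forall t, exists2 F, F \in supp (f t) & val F \in sub_simplex J.

Lemma subcomplex_retraction :
  exists r : T -> realization R (complex_of_subcomplex J), continuous r /\
    forall t p, p \in supp (r t) -> exists2 F, F \in supp (f t) & val p \in val F.
Proof.
pose w t (p : complex_of_subcomplex J) : R :=
  \sum_(F : Sd L | (val F \in sub_simplex J) && (val p \in val F)) val (f t) F.
have wc p : continuous (w ^~ p).
  apply: continuous_sum => F _ t.
  apply: (@continuous_comp _ _ _ f (fun x : realization R (Sd L) => val x F : R)).
    exact: f_cont.
  exact: coord_continuous.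
have w0 t p : 0 <= w t p by apply: sumr_ge0 => F _; exact: realization_ge0.
have wP t (p : complex_of_subcomplex J) : reflect
    (exists F, [/\ F \in supp (f t), val F \in sub_simplex J & val p \in val F])
    (w t p != 0).
  rewrite /w sum_coord_neq0.
  apply: (iffP existsP) => [[F /andP[/andP[FJ pF] fF]]|[F [fF FJ pF]]].
    by exists F.
  by exists F; rewrite FJ pF.
have lift (F : Sd L) v : val F \in sub_simplex J -> v \in val F ->
    [set v] \in sub_simplex J.
  move=> FJ vF; apply: sub_simplex_sub FJ _ _; first by rewrite finset.sub1set.
  by apply/set0Pn; exists v; rewrite inE.
have wneq0 t : exists p, w t p != 0.
  have [F fF FJ] := f_meets t.
  have [v vF] := set0Pn _ (simplex_neq0 (valP F)).
  exists (@exist _ (fun v => [set v] \in sub_simplex J) _ (lift F _ FJ vF)).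
  by apply/wP; exists F.
have wsimplex t : exists2 s, s \in simplex (complex_of_subcomplex J) &
    closed_simplex s (w t).
  pose c : {set Sd L} := [set F in supp (f t) | val F \in sub_simplex J].
  have cSd : c \in simplex (Sd L).
    apply: simplex_sub (supp_simplex (f t)) _ _.
      by apply/fintype.subsetP => F; rewrite inE => /andP[].
    have [F fF FJ] := f_meets t.
    by apply/set0Pn; exists F; rewrite inE fF.
  (* The faces of [J] in the support form a chain, whose largest member contains every vertex of
     nonzero weight. *)
  have [M + cM] := sd_chain_max cSd; rewrite inE => /andP[fM MJ].
  exists [set p | val p \in val M]; last first.
    move=> p /wP[F [fF FJ pF]]; rewrite inE.
    by apply: (fintype.subsetP (cM F _)) => //; rewrite inE fF.
  rewrite inE; suff -> : val @: [set p : sub_vertex J | val p \in val M] = val M.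
    by [].
  apply/setP => v; apply/imsetP/idP => [[p + ->]|vM]; first by rewrite inE.
  exists (@exist _ (fun v => [set v] \in sub_simplex J) _ (lift M _ MJ vM)) => //.
  by rewrite inE.
have [r [rc rs]] := normalize wc w0 wsimplex wneq0.
exists r; split=> // t p; rewrite rs inE => /wP[F [fF _ pF]].
by exists F.
Qed.

End SubcomplexNeighborhood.

(** Consecutive maps of a contiguity send the support of [r t] into a common simplex, so [c] linear
    homotopies can be chained. *)
Lemma contiguous_homotopic (T : topologicalType) (K L : complex) c
    (f g : smap K L) (r : T -> realization R K) :
  continuous r -> contiguous c f g ->
  homotopic (fun t => realize f (r t)) (fun t => realize g (r t)).
Proof.
move=> rc [h [h0 hc hs]].
have cr (k : smap K L) : continuous (fun t => realize k (r t)).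
  by move=> t; apply: continuous_comp; [exact: rc|exact: realize_continuous].
have hh i : (i <= c)%N ->
    homotopic (fun t => realize f (r t)) (fun t => realize (h i) (r t)).
  elim: i => [_|i IH ic].
    apply: homotopic_supp => // t; rewrite !supp_realize (eq_imset _ h0) finset.setUid.
    by apply: smapP; exact: supp_simplex.
  apply: homotopic_trans (IH (ltnW ic)) _.
  apply: homotopic_supp => // t; rewrite !supp_realize.
  by apply: (hs i.+1) => //; exact: supp_simplex.
apply: homotopic_trans (hh c (leqnn c)) _.
apply: homotopic_supp => // t; rewrite !supp_realize (eq_imset _ hc) finset.setUid.
by apply: smapP; exact: supp_simplex.
Qed.

Lemma homotopic_sub (T : topologicalType) (K : complex)
    (f g : T -> realization R K) :
  continuous f -> continuous g -> (forall t, supp (f t) \subset supp (g t)) ->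
  homotopic f g /\ homotopic g f.
Proof.
move=> fc gc fg; split; apply: homotopic_supp => // t.
  by rewrite (finset.setUidPr (fg t)) supp_simplex.
by rewrite (finset.setUidPl (fg t)) supp_simplex.
Qed.

Variable K : ordered_complex.
Variable iota : forall b : nat, smap (Sd (SdP K b)) (SdP K b).
Hypothesis iota_mem : forall b (F : Sd (SdP K b)), iota b F \in val F.

Local Notation X := (realization R K).

(** Each subdivision step composes with [sd_inverse]: a face [F] in the new support lies inside the
    old support, and [iota b F] is one of its vertices. *)
Lemma iota_iter_inverse b : exists g : X * X -> realization R (SdP K b),
  continuous g /\ forall z p, p \in supp (g z) ->
    pi1 iota b p \in supp z.1 /\ pi2 iota b p \in supp z.2.
Proof.
elim: b => [|b [g [gc gs]]]; first exact: prod_inverse.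
have [h [hc hs]] := @sd_inverse R (SdP K b).
exists (h \o g); split.
  by move=> z; apply: continuous_comp; [exact: gc|exact: hc].
by move=> z F /hs/fintype.subsetP/(_ _ (iota_mem F))/gs.
Qed.

Lemma TC_cover_of_SC_cover b c n : SC_cover iota b c n -> TC_cover R X n.
Proof.
move=> [J [J_cover J_contig]].
have [g [gc gs]] := iota_iter_inverse b.
(* One more subdivision is taken so that the points near [J i] can be described by an open
   condition, the positivity of [W i]. *)
have [h [hc hs]] := @sd_inverse R (SdP K b).
have hgc : continuous (h \o g).
  by move=> z; apply: continuous_comp; [exact: gc|exact: hc].
pose W i z : R :=
  \sum_(F : Sd (SdP K b) | val F \in sub_simplex (J i)) val (h (g z)) F.
have WP i z : 0 < W i z <->
    exists2 F, F \in supp (h (g z)) & val F \in sub_simplex (J i).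
  have W0 : 0 <= W i z by apply: sumr_ge0 => F _; exact: realization_ge0.
  rewrite lt_neqAle W0 eq_sym andbT /W sum_coord_neq0.
  split=> [/existsP[F /andP[FJ hF]]|[F hF FJ]]; first by exists F.
  by apply/existsP; exists F; rewrite FJ.
exists (fun i => [set z | 0 < W i z]%classic); split.
- move=> i; apply: (@open_comp _ _ (W i) [set r : R | 0 < r]%classic).
    move=> z _; move: z; apply: continuous_sum => F _ z.
    apply: (@continuous_comp _ _ _ (h \o g)
      (fun x : realization R (Sd (SdP K b)) => val x F : R)); first exact: hgc.
    exact: coord_continuous.
  exact: open_gt.
- apply/seteqP; split=> // z _.
  (* The support of [g z] is a simplex of some [J i], and then so is every face in the support of
     [h (g z)]. *)
  have [i gJ] := J_cover _ (supp_simplex (g z)); exists i => //=.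
  apply/WP.
  have [F hF] := set0Pn _ (simplex_neq0 (supp_simplex (h (g z)))).
  exists F => //; apply: sub_simplex_sub gJ (hs _ _ hF) _.
  exact: simplex_neq0 (valP F).
move=> i; set U := [set z | 0 < W i z]%classic.
have vc : continuous (fun u : set_type U => val u) by exact: initial_continuous.
have comp_val (Y : topologicalType) (k : X * X -> Y) :
    continuous k -> continuous (fun u : set_type U => k (val u)).
  move=> kc u; apply: (@continuous_comp _ _ _ (fun u : set_type U => val u) k).
    exact: vc.
  exact: kc.
have [r [rc rs]] :
    exists r : set_type U -> realization R (complex_of_subcomplex (J i)),
    continuous r /\
    forall t p, p \in supp (r t) -> val p \in supp (g (val t)).
  have [|u|r [rc rs]] := @subcomplex_retraction _ (J i) _
    (fun u : set_type U => h (g (val u))).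
  - exact: (comp_val _ (h \o g)).
  - by apply/WP; exact: set_mem (valP u).
  exists r; split=> // t p /rs[F /hs/fintype.subsetP + pF]; exact.
suff [sigma [sigmac sigmaE]] : exists sigma : set_type U -> path_space R X,
    continuous sigma /\ forall u, path_ends (sigma u) = ((val u).1, (val u).2).
  by exists sigma; split=> // u; rewrite sigmaE -surjective_pairing.
apply: homotopic_section.
have fst_c : continuous (fun u : set_type U => (val u).1).
  by apply: (comp_val _ fst) => z; exact: cvg_fst.
have snd_c : continuous (fun u : set_type U => (val u).2).
  by apply: (comp_val _ snd) => z; exact: cvg_snd.
have rg_c (k : smap (SdP K b) K) :
    continuous (fun u : set_type U => realize k (g (val u))).
  move=> u; apply: continuous_comp; last exact: realize_continuous.
  exact: (comp_val _ g).
have rr_c (k : smap (SdP K b) K) :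
    continuous (fun u : set_type U => realize (restriction (J i) k) (r u)).
  by move=> u; apply: continuous_comp; [exact: rc|exact: realize_continuous].
have rg_sub (k : smap (SdP K b) K) u :
    supp (realize (restriction (J i) k) (r u)) \subset supp (realize k (g (val u))).
  rewrite !supp_realize; apply/fintype.subsetP => _ /imsetP[p rp ->].
  by apply: imset_f; exact: rs.
have pi1_sub (u : set_type U) :
    supp (realize (pi1 iota b) (g (val u))) \subset supp (val u).1.
  rewrite supp_realize; apply/fintype.subsetP => _ /imsetP[p gp ->].
  by have [] := gs _ _ gp.
have pi2_sub (u : set_type U) :
    supp (realize (pi2 iota b) (g (val u))) \subset supp (val u).2.
  rewrite supp_realize; apply/fintype.subsetP => _ /imsetP[p gp ->].
  by have [] := gs _ _ gp.
(* The five stages run from [z.1] to [pi1] of [g z], to [pi1] of the retracted point [r], to [pi2]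
   of [r], to [pi2] of [g z], to [z.2]. *)
have [_ H1] := homotopic_sub (rg_c _) fst_c pi1_sub.
have [_ H2] := homotopic_sub (rr_c (pi1 iota b)) (rg_c _) (rg_sub _).
have H3 := contiguous_homotopic rc (J_contig i).
have [H4 _] := homotopic_sub (rr_c (pi2 iota b)) (rg_c _) (rg_sub _).
have [H5 _] := homotopic_sub (rg_c _) snd_c pi2_sub.
apply: homotopic_trans H1 _; apply: homotopic_trans H2 _.
by apply: homotopic_trans H3 _; apply: homotopic_trans H4 H5.
Qed.

End FromSimplicial.

(** * Averages and the mesh of subdivisions *)

Section Averages.
Variables (R : realType) (I : finType) (a : I -> R).

Definition average (F : {set I}) : R := (\sum_(q in F) a q) / #|F|%:R.

(** In [average F - a g], averaged over [g] in [G], the terms with [g] in [F] cancel. The others are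
    at most [d] and form a proportion [1 - #|F| / #|G|], at most [1 - 1 / N]. *)
Lemma average_dist (F G : {set I}) (N : nat) (d : R) :
  F != finset.set0 -> F \subset G -> (#|G| <= N)%N ->
  {in G &, forall q r, `|a q - a r| <= d} ->
  `|average F - average G| <= (1 - N%:R^-1) * d.
Proof.
move=> F0 FG GN ad.
have [q0 q0F] := set0Pn _ F0; have q0G := fintype.subsetP FG _ q0F.
have d0 : 0 <= d by have := ad _ _ q0G q0G; rewrite subrr normr0.
have cF : (0 < #|F|)%N by rewrite card_gt0.
have cFG : (#|F| <= #|G|)%N by exact: subset_leq_card.
have cG : (0 < #|G|)%N by exact: leq_trans cFG.
have cF0 : #|F|%:R != 0 :> R by rewrite pnatr_eq0 -lt0n.
have cG0 : #|G|%:R != 0 :> R by rewrite pnatr_eq0 -lt0n.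
have devF g : average F - a g = (\sum_(q in F) (a q - a g)) / #|F|%:R.
  by rewrite sumrB sumr_const mulrBl -[a g *+ _]mulr_natr mulfK.
have dF g : g \in G -> `|average F - a g| <= d.
  move=> gG; rewrite devF normrM normfV normr_nat ler_pdivrMr ?ltr0n//.
  apply: le_trans (ler_norm_sum _ _ _) _.
  rewrite mulr_natr -sumr_const; apply: ler_sum => q qF.
  by apply: ad => //; exact: (fintype.subsetP FG).
have -> : average F - average G = (\sum_(g in G :\: F) (average F - a g)) / #|G|%:R.
  have -> : average F - average G = (\sum_(g in G) (average F - a g)) / #|G|%:R.
    by rewrite sumrB sumr_const mulrBl -[average F *+ _]mulr_natr mulfK.
  rewrite [X in X / _](big_setID F)/= (finset.setIidPr FG).
  rewrite [X in X + _](_ : _ = 0) ?add0r//.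
  by rewrite sumrB sumr_const -[average F *+ _]mulr_natr divfK// subrr.
rewrite normrM normfV normr_nat ler_pdivrMr ?ltr0n//.
apply: (@le_trans _ _ (#|G :\: F|%:R * d)).
  apply: le_trans (ler_norm_sum _ _ _) _.
  rewrite mulr_natl -sumr_const; apply: ler_sum => q; rewrite inE => /andP[_].
  exact: dF.
rewrite mulrAC ler_wpM2r// cardsD (finset.setIidPr FG) natrB//.
have N0 : (0 < N)%N by exact: leq_trans GN.
rewrite mulrBl mul1r lerD2l lerN2 mulrC ler_pdivrMr ?ltr0n//.
by rewrite -natrM ler_nat (leq_trans GN)// leq_pmull.
Qed.

End Averages.

(** * Positions of the vertices of iterated subdivisions *)

Section Locations.
Variable R : realType.

(** Cardinality is injective on a chain of faces, so a chain is no longer than its largest face is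
    big. This keeps the contraction factor of the mesh uniform in [b]. *)
Lemma card_sd_simplex (L : complex) (N : nat) :
  (forall s, s \in simplex L -> (#|s| <= N)%N) ->
  forall c, c \in simplex (Sd L) -> (#|c| <= N)%N.
Proof.
move=> LN c cL; have [M Mc cM] := sd_chain_max cL.
have cardF (F : Sd L) : (0 < #|val F|)%N.
  by rewrite card_gt0 simplex_neq0// (valP F).
have f_inj : {in c &, injective (fun F : Sd L => #|val F|)}.
  move=> F G Fc Gc /= FG; apply/val_inj/eqP.
  move: cL; rewrite inE => /andP[_ /forall_inP/(_ _ Fc)/forall_inP/(_ _ Gc)].
  by case/orP => FG_sub; [|rewrite eq_sym]; rewrite eqEcard FG_sub FG leqnn.
apply: leq_trans (LN _ (valP M)).
have -> : #|c| = size [seq #|val (F : Sd L)| | F <- enum c].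
  by rewrite size_map -cardE.
rewrite -(size_iota 1 #|val M|); apply: uniq_leq_size.
  rewrite map_inj_in_uniq ?enum_uniq// => F G; rewrite !mem_enum.
  exact: f_inj.
move=> k /mapP[F + ->]; rewrite mem_enum mem_iota => /cM/subset_leq_card FM.
by rewrite cardF /= add1n ltnS.
Qed.

Section SdLocation.
Variables (L K : complex) (loc : L -> realization R K).

(** This is the condition for barycenters of locations of vertices of a simplex to stay in the
    realization of [K]. *)
Definition carried := forall s, s \in simplex L ->
  exists2 t, t \in simplex K & forall q, q \in s -> supp (loc q) \subset t.

Hypothesis loc_carried : carried.

Lemma average_subproof (F : Sd L) :
  ((fun v => average (fun q => val (loc q) v) (val F) : R)
    : {ptws K -> R}) \in @barycentric R K.
Proof.
apply/mem_set; split.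
- move=> v; rewrite divr_ge0 ?ler0n// sumr_ge0// => q _.
  exact: realization_ge0.
- rewrite -mulr_suml exchange_big /= (eq_bigr (fun=> 1)).
    by rewrite sumr_const divff// pnatr_eq0 -lt0n card_gt0 simplex_neq0// (valP F).
  by move=> q _; exact: realization_sum.
- have [t tK Ft] := loc_carried (valP F); exists t => // v.
  apply: contraR => vt; rewrite /average big1 ?mul0r// => q /Ft/fintype.subsetP qt.
  by apply/eqP; apply: contraNT vt; rewrite -in_supp; exact: qt.
Qed.

Definition sd_location (F : Sd L) : realization R K :=
  SigSub (average_subproof F).

Lemma supp_sd_location (F : Sd L) (v : K) :
  v \in supp (sd_location F) <-> exists2 q, q \in val F & v \in supp (loc q).
Proof.
have cF : #|val F|%:R != 0 :> R.
  by rewrite pnatr_eq0 -lt0n card_gt0 simplex_neq0// (valP F).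
rewrite in_supp mulf_eq0 invr_eq0 (negPf cF) orbF psumr_neq0; last first.
  by move=> q _; exact: realization_ge0.
split=> [/hasP[q _ /andP[qF qv]]|[q qF qv]].
  by exists q; rewrite // in_supp gt_eqF.
apply/hasP; exists q; first exact: mem_index_enum.
by rewrite qF lt_neqAle realization_ge0 eq_sym -in_supp qv.
Qed.

End SdLocation.

Lemma sd_location_carried (L K : complex) (loc : L -> realization R K)
  (loc_carried : carried loc) : carried (sd_location loc_carried).
Proof.
move=> c /sd_chain_max[M Mc cM].
have [t tK Mt] := loc_carried _ (valP M); exists t => // F /cM/fintype.subsetP FM.
apply/fintype.subsetP => v /supp_sd_location[q /FM/Mt/fintype.subsetP qt].
exact: qt.
Qed.

Variable K : ordered_complex.
Variable iota : forall b : nat, smap (Sd (SdP K b)) (SdP K b).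
Hypothesis iota_mem : forall b (F : Sd (SdP K b)), iota b F \in val F.

(** A crude bound on the size of simplices; the successor keeps it nonzero for the empty complex, so
    that [1 - 1 / N] is always less than 1. *)
Let N := #|SdP K 0|.+1.

Lemma card_SdP_simplex b s : s \in simplex (SdP K b) -> (#|s| <= N)%N.
Proof.
elim: b s => [|b IH]; last exact: card_sd_simplex.
by move=> s _; rewrite (leq_trans (max_card _)).
Qed.

(** For a projection [pr], [loc p] is that component of the vertex [p] seen as a point of the
    square. New vertices are barycenters, so each subdivision shrinks the mesh by the factor of
    [average_dist]. *)
Lemma locations (pr : smap (prod_complex K K) K) b :
  exists loc : SdP K b -> realization R K,
  [/\ carried loc, forall p, pr (iota_iter iota b p) \in supp (loc p) &
      forall s, s \in simplex (SdP K b) -> {in s &, forall p q v,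
        `|val (loc p) v - val (loc q) v| <= (1 - N%:R^-1) ^+ b}].
Proof.
elim: b => [|b [loc [loc_carried loc_pr loc_mesh]]].
  exists (fun p => vertex_point R (pr p)); split.
  - move=> s sP; exists (pr @: s); first exact: smapP.
    move=> q qs; rewrite supp_vertex_point finset.sub1set; exact: imset_f.
  - by move=> p; rewrite supp_vertex_point inE.
  - move=> s _ p q _ _ v /=; rewrite expr0.
    by case: (_ == _); case: (_ == _);
      rewrite ?subrr ?subr0 ?sub0r ?normrN ?normr0 ?normr1 ?ler01.
exists (sd_location loc_carried); split.
- exact: sd_location_carried.
- move=> F; apply/supp_sd_location.
  by exists (iota b F); [exact: iota_mem|exact: loc_pr].
- move=> c cS F G Fc Gc v.
  have dist (A B : Sd (SdP K b)) : val A \subset val B ->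
      `|val (sd_location loc_carried A) v - val (sd_location loc_carried B) v|
        <= (1 - N%:R^-1) ^+ b.+1.
    move=> AB; rewrite exprS; apply: average_dist => //.
    - exact: simplex_neq0 (valP A).
    - exact: card_SdP_simplex (valP B).
    - by move=> q r qB rB; apply: loc_mesh (valP B) _ _ qB rB _.
  move: cS; rewrite inE => /andP[_ /forall_inP/(_ _ Fc)/forall_inP/(_ _ Gc)].
  by case/orP => /dist; rewrite // distrC.
Qed.

Lemma mesh_cvg0 :
  ((fun b => (1 - N%:R^-1 : R) ^+ b) @ \oo --> (0 : R))%classic.
Proof.
apply: cvg_expr; rewrite ger0_norm; first by rewrite gtrBl invr_gt0 ltr0n.
by rewrite subr_ge0 invf_le1 ?ltr0n// ler1n.
Qed.

End Locations.

(** * Compactness *)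

Section Compactness.
Variable R : realType.
Local Open Scope classical_set_scope.

Lemma compact_set_type (T : topologicalType) (A : set T) :
  compact A -> compact [set: set_type A].
Proof.
move=> Ac F PF _.
have [x [Ax Fx]] : A `&` cluster (val @ F) !=set0.
  apply: Ac; apply: (@filterS _ F _ setT _ _ filterT).
  by move=> u _; exact: set_mem (valP u).
exists (SigSub (mem_set Ax)); split=> // B C FB [_ [[W oW <-] Wx WC]].
have [y [[u Bu uy] Wy]] : (val @` B) `&` W !=set0.
  apply: Fx; last exact: open_nbhs_nbhs.
  by apply: (@filterS _ F _ B) FB => u Bu; exists u.
by exists u; split=> //; apply: WC; rewrite /= /set_val /= uy.
Qed.

Lemma hausdorff_set_type (T : topologicalType) (A : set T) :
  hausdorff_space T -> hausdorff_space (set_type A).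
Proof.
move=> hT p q pq; apply/val_inj/hT => B C Bp Cq.
have vc := @initial_continuous (set_type A) T set_val.
by have [u [Bu Cu]] := pq _ _ (vc p _ Bp) (vc q _ Cq); exists (val u).
Qed.

Lemma unit_interval_compact : compact [set: unit_interval R].
Proof. by apply: compact_set_type; exact: segment_compact. Qed.

Lemma unit_interval_locally_compact : locally_compact [set: unit_interval R].
Proof.
move=> x _; exists setT; first exact: filterT.
by split; [exact: unit_interval_compact|exact: closedT].
Qed.

Lemma unit_interval_hausdorff : hausdorff_space (unit_interval R).
Proof. by apply: hausdorff_set_type; exact: Rhausdorff. Qed.

Lemma barycentric_closed (K : complex) : closed (@barycentric R K).
Proof.
have ec v : continuous (fun x : {ptws K -> R} => x v : R).
  by move=> x; exact: (@proj_continuous K (fun=> R) v).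
have -> : @barycentric R K =
    (\bigcap_(v in [set: K]) [set x : {ptws K -> R} | 0 <= x v]) `&`
    [set x : {ptws K -> R} | \sum_v x v = 1] `&`
    \bigcup_(s in [set s | s \in simplex K])
      \bigcap_(v in [set v | v \notin s]) [set x : {ptws K -> R} | x v = 0].
  apply/seteqP; split=> x.
    move=> [x0 x1 [s sK xs]]; split; first by split=> // v _; exact: x0.
    by exists s => // v /= vs; apply/eqP; apply: contraNT vs; exact: xs.
  move=> [[x0 x1] [s sK xs]]; split=> //; first by move=> v; exact: x0.
  by exists s => // v; apply: contraR => vs; apply/eqP; exact: xs.
apply: closedI; first apply: closedI.
- apply: closed_bigI => v _.
  apply: (@preimage_closed _ _ (fun x : {ptws K -> R} => x v : R)
    [set r | 0 <= r]); last exact: closed_ge.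
  by move=> x _; exact: ec.
- apply: (@preimage_closed _ _ (fun x : {ptws K -> R} => \sum_v x v : R)
    [set r | r = 1]); last exact: closed_eq.
  by move=> x _; move: x; apply: continuous_sum => v _; exact: ec.
- apply: closed_bigcup; first exact: finite_finset.
  move=> s _; apply: closed_bigI => v _.
  apply: (@preimage_closed _ _ (fun x : {ptws K -> R} => x v : R)
    [set r | r = 0]); last exact: closed_eq.
  by move=> x _; exact: ec.
Qed.

Lemma realization_compact (K : complex) : compact [set: realization R K].
Proof.
apply: compact_set_type; apply: (subclosed_compact (@barycentric_closed K)).
  apply: (@tychonoff K (fun=> R) (fun=> `[0, 1])) => _; exact: segment_compact.
move=> x [x0 x1 _] v; rewrite /= in_itv /= x0 -x1 (bigD1 v)//= lerDl.
exact: sumr_ge0.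
Qed.

(** The sup-distance on barycentric coordinates; [close_nbhs] and [nbhs_close] show that it induces
    the topology. *)
Definition close (K : complex) (d : R) (x y : realization R K) :=
  forall v, `|val x v - val y v| < d.

Lemma close_nbhs (K : complex) d (x : realization R K) :
  0 < d -> nbhs x (close d x).
Proof.
move=> d0.
have xd v : \forall y \near x, `|val x v - val y v| < d.
  by have /cvgr_dist_lt := @coord_continuous R K v x; exact.
exact: filter_forall xd.
Qed.

Lemma nbhs_close (K : complex) (x : realization R K) A :
  nbhs x A -> exists2 d, 0 < d & close d x `<=` A.
Proof.
move=> xA; pose F := filter_from [set d : R | 0 < d] (fun d => close d x).
have FF : Filter F.
  apply: filter_from_filter; first by exists 1 => /=.
  move=> d e /= d0 e0; exists (Num.min d e); first by rewrite /= lt_min d0.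
  by move=> y xy; split=> v; have := xy v; rewrite lt_min => /andP[].
suff /(_ _ xA)[d d0 dA] : F --> x by exists d.
move=> U [_ [[W oW <-] Wx WA]]; apply: (@filterS _ F _ _ _ WA).
have : (val : realization R K -> {ptws K -> R}) @ F --> (val x : {ptws K -> R}).
  apply/cvg_sup => v U' [_ [[B Bo <-] /= Bx BC]]; apply: (filterS BC).
  have /nbhs_ballP[d /= d0 dB] : nbhs (val x v) B by exact: open_nbhs_nbhs.
  by exists d => // y xy; apply: dB; exact: xy.
by apply; exact: open_nbhs_nbhs.
Qed.

Lemma closeD (K : complex) d e (x y z : realization R K) :
  close d x y -> close e y z -> close (d + e) x z.
Proof.
move=> xy yz v; have := xy v; have := yz v.
have := ler_normD (val x v - val y v) (val y v - val z v).
by rewrite addrA subrK; lra.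
Qed.

Lemma close_sym (K : complex) d (x y : realization R K) :
  close d x y -> close d y x.
Proof. by move=> xy v; rewrite distrC. Qed.

(** Around [z0], half of the available radius absorbs the move from [z0] to [z] and the other half
    the move from [z] to [y]; compactness makes one radius [1 / (n + 1)] serve all [z]. *)
Lemma lebesgue_number (K L : complex)
    (Q : set (set (realization R K * realization R L))) :
  (forall z : realization R K * realization R L, exists2 A, nbhs z A & Q A) ->
  exists2 d, 0 < d & forall z, exists2 A, Q A &
    forall y, close d z.1 y.1 -> close d z.2 y.2 -> A y.
Proof.
move=> zQ.
pose P (n : nat) z := exists2 A, Q A &
    forall y : realization R K * realization R L,
      close n.+1%:R^-1 z.1 y.1 -> close n.+1%:R^-1 z.2 y.2 -> A y.
have XX : compact [set: realization R K * realization R L].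
  by rewrite -setXTT; apply: compact_setX; exact: realization_compact.
have cover : \forall n \near \oo, [set: realization R K * realization R L] `<=` P n.
  move/compact_near_coveringP: XX; apply=> z0 _.
  have [A [[B C] /= [zB zC] BCA] QA] := zQ z0.
  have [d d0 dB] := nbhs_close zB; have [e e0 eC] := nbhs_close zC.
  have d20 : 0 < d / 2 by lra.
  have e20 : 0 < e / 2 by lra.
  exists (close (d / 2) z0.1 `*` close (e / 2) z0.2,
          [set n | n.+1%:R^-1 < d / 2] `&` [set n | n.+1%:R^-1 < e / 2]).
    split; last first.
      by apply: filterI; [exact: (near_infty_natSinv_lt (PosNum d20))
                         |exact: (near_infty_natSinv_lt (PosNum e20))].
    exists (close (d / 2) z0.1, close (e / 2) z0.2) => //.
    by split; exact: close_nbhs.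
  move=> [z n] /= [[zd ze] [nd ne]].
  exists A => // y zy1 zy2; apply: BCA; split=> /=.
    apply: dB; rewrite [d]splitr; apply: closeD zd _ => v.
    exact: lt_trans (zy1 v) nd.
  apply: eC; rewrite [e]splitr; apply: closeD ze _ => v.
  exact: lt_trans (zy2 v) ne.
have [n nP] := filter_ex cover.
by exists n.+1%:R^-1 => [|z]; [rewrite invr_gt0 ltr0n|exact: nP].
Qed.

Lemma path_modulus (K : complex) (g : unit_interval R -> realization R K) (e : R) :
  continuous g -> 0 < e ->
  \forall m \near \oo, forall s t : unit_interval R,
    `|val s - val t| < m.+1%:R^-1 -> close e (g s) (g t).
Proof.
move=> gc e0.
have e20 : 0 < e / 2 by lra.
pose P (m : nat) (s : unit_interval R) := forall t : unit_interval R,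
    `|val s - val t| < m.+1%:R^-1 -> close e (g s) (g t).
suff : \forall m \near \oo, [set: unit_interval R] `<=` P m.
  by apply: filterS => m mP s t; exact: mP.
move/compact_near_coveringP: unit_interval_compact; apply=> t0 _.
have [_ [[W oW <-] Wt0 WA]] := gc t0 _ (close_nbhs (g t0) e20).
have /nbhs_ballP[d /= d0 dW] : nbhs (val t0 : R) W by exact: open_nbhs_nbhs.
have d20 : 0 < d / 2 by lra.
have near_t0 (t : unit_interval R) :
    `|val t0 - val t| < d -> close (e / 2) (g t0) (g t).
  by move=> t0t; apply: WA; exact: dW.
exists ([set s : unit_interval R | `|val t0 - val s| < d / 2],
        [set n | n.+1%:R^-1 < d / 2]).
  split; last exact: (near_infty_natSinv_lt (PosNum d20)).
  have /cvgr_dist_lt : (set_val s : R) @[s --> t0] --> (set_val t0 : R).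
    exact: initial_continuous.
  exact.
move=> [s m] /= [st0 md] t st; rewrite [e]splitr.
apply: (@closeD _ _ _ _ (g t0)); first by apply/close_sym/near_t0; lra.
apply: near_t0; rewrite -[val t0](subrK (val s)) -addrA [d]splitr.
by apply: le_lt_trans (ler_normD _ _) _; rewrite ltrD// (lt_trans st md).
Qed.

(** The interval is locally compact and Hausdorff, so [sigma] uncurries to a jointly continuous map;
    compactness of the interval then gives a neighborhood of [u0] valid at all times. *)
Lemma tube (K : complex) (T : topologicalType)
    (sigma : T -> path_space R (realization R K)) (u0 : T) (e : R) :
  continuous sigma -> 0 < e ->
  \forall u \near u0, forall t : unit_interval R, close e (sigma u0 t) (sigma u t).
Proof.
move=> sc e0.
have e20 : 0 < e / 2 by lra.
pose f (u : T) : unit_interval R -> realization R K := sigma u.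
have fc : continuous (f : T -> {compact-open, unit_interval R -> realization R K}).
  move=> u; apply: (@continuous_comp T (path_space R (realization R K))
    {compact-open, unit_interval R -> realization R K} sigma
    (fun g => g : unit_interval R -> realization R K)); first exact: sc.
  exact: initial_continuous.
have fc' : continuous (uncurry f).
  apply: (continuous_uncurry unit_interval_locally_compact
    unit_interval_hausdorff fc) => u.
  exact: cts_fun.
pose P (u : T) (t : unit_interval R) := close e (f u0 t) (f u t).
suff : \forall u \near u0, [set: unit_interval R] `<=` P u.
  by apply: filterS => u uP t; exact: uP.
move/compact_near_coveringP: unit_interval_compact; apply=> t0 _.
have [[A B] /= [Au0 Bt0] AB] := fc' (u0, t0) _ (close_nbhs (f u0 t0) e20).
exists (B, A) => // -[t u] /= [Bt Au]; rewrite /P [e]splitr.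
apply: closeD (close_sym (AB (u0, t) _)) (AB (u, t) _); split=> //=.
exact: nbhs_singleton Au0.
Qed.

End Compactness.

(** * From motion planning to contiguity *)

Section ToSimplicial.
Variable R : realType.

(** A maximal coordinate is at least the mean [1 / #|K|], so a change smaller than [1 / (#|K| + 1)]
    cannot bring it down to 0. *)
Lemma argmax_supp (K : complex) (x y : realization R K) (m : K) :
  (forall v, val x v <= val x m) -> close #|K|.+1%:R^-1 x y -> m \in supp y.
Proof.
move=> xm xy; have xm1 : #|K|.+1%:R^-1 <= val x m.
  have : 1 <= #|K|%:R * val x m.
    rewrite -[leLHS](realization_sum x) mulr_natl -sumr_const.
    by apply: ler_sum => v _; exact: xm.
  rewrite -div1r ler_pdivrMr ?ltr0n// -natr1 mulrDr mulr1 [#|K|%:R * _]mulrC.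
  by have := realization_ge0 x m; lra.
rewrite in_supp gt_eqF//; have := le_lt_trans (ler_norm _) (xy m).
by rewrite ltrBlDr => /(le_lt_trans xm1); rewrite ltrDl.
Qed.

Section ContiguousOfPaths.
Variables (L K : complex) (f g : smap L K) (m : nat).
Variable y : L -> unit_interval R -> realization R K.
Let e : R := #|K|.+1%:R^-1.

Hypothesis y_start : forall s, s \in simplex L -> exists2 t, t \in simplex K &
  forall q, q \in s -> f q \in t /\ supp (y q (SigSub (unit_interval0 R))) \subset t.
Hypothesis y_end : forall s, s \in simplex L -> exists2 t, t \in simplex K &
  forall q, q \in s -> g q \in t /\ supp (y q (SigSub (unit_interval1 R))) \subset t.
Hypothesis y_close : forall s, s \in simplex L -> {in s &, forall p q t,
  close (e / 2) (y p t) (y q t)}.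
Hypothesis y_modulus : forall p s t, `|val s - val t| < m.+1%:R^-1 ->
  close (e / 2) (y p s) (y p t).

(** With [m + 2] time steps, each is strictly shorter than the [1 / (m + 1)] of [y_modulus]. *)
Let N := m.+2.

Let time_subproof k : Num.min 1 (k%:R / N%:R : R) \in `[0, 1]%classic.
Proof.
apply/mem_set; rewrite /= in_itv /= le_min ler01 ge_min lexx /= andbT.
by rewrite divr_ge0 ?ler0n.
Qed.

Let time k : unit_interval R := SigSub (time_subproof k).

Let time_start : time 0 = SigSub (unit_interval0 R).
Proof. by apply/val_inj; rewrite /= mul0r min_r. Qed.

Let time_end : time N = SigSub (unit_interval1 R).
Proof. by apply/val_inj; rewrite /= divff ?pnatr_eq0// minxx. Qed.

Let time_step k : `|val (time k) - val (time k.+1)| < m.+1%:R^-1.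
Proof.
apply: (@le_lt_trans _ _ (N%:R^-1)); last first.
  by rewrite ltf_pV2 ?posrE ?ltr0n// ltr_nat.
rewrite /=; have -> : k.+1%:R / N%:R = k%:R / N%:R + N%:R^-1 :> R.
  by rewrite -[k.+1%:R]natr1 mulrDl mul1r.
have N0 : 0 <= N%:R^-1 :> R by rewrite invr_ge0.
move: (N%:R^-1 : R) (k%:R * _) N0 => d a d0.
rewrite ler_norml; have [] := leP 1 a; have [] := leP 1 (a + d); lra.
Qed.

(* [f q] is only the default value of [arg max]. *)
Let peak k q : K := [arg max_(v > f q) val (y q (time k)) v]%O.

Let peakP k q v : val (y q (time k)) v <= val (y q (time k)) (peak k q).
Proof. by rewrite /peak; case: Order.TotalTheory.arg_maxP => // w _; exact. Qed.

(** Changing the vertex and changing the time cost [e / 2] each, which together is what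
    [argmax_supp] tolerates. *)
Let peak_supp s p q j k : s \in simplex L -> p \in s -> q \in s ->
  `|val (time k) - val (time j)| < m.+1%:R^-1 ->
  peak k q \in supp (y p (time j)).
Proof.
move=> sL ps qs jk; apply: (argmax_supp (peakP k q)); rewrite -/e [e]splitr.
by apply: closeD (y_close sL qs ps (time k)) (y_modulus _ jk).
Qed.

Let peak_self s p q k : s \in simplex L -> p \in s -> q \in s ->
  peak k q \in supp (y p (time k)).
Proof.
move=> sL ps qs; apply: (@peak_supp s p q) => //.
by rewrite subrr normr0 invr_gt0 ltr0n.
Qed.

Let imset_simplex (h : L -> K) s t : s \in simplex L -> t \in simplex K ->
  (forall q, q \in s -> h q \in t) -> h @: s \in simplex K.
Proof.
move=> sL tK st; apply: simplex_sub tK _ _.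
  by apply/fintype.subsetP => _ /imsetP[q qs ->]; exact: st.
by rewrite imset_eq0 simplex_neq0.
Qed.

Let imset2_simplex (h h' : L -> K) s t : s \in simplex L -> t \in simplex K ->
  (forall q, q \in s -> h q \in t) -> (forall q, q \in s -> h' q \in t) ->
  h @: s :|: h' @: s \in simplex K.
Proof.
move=> sL tK st st'; apply: simplex_sub tK _ _.
  apply/fintype.subsetP => v; rewrite inE => /orP[] /imsetP[q qs ->].
    exact: st.
  exact: st'.
have [q qs] := set0Pn _ (simplex_neq0 sL); apply/set0Pn; exists (h q).
by rewrite inE imset_f.
Qed.

Let peak_subproof k s : s \in simplex L -> peak k @: s \in simplex K.
Proof.
move=> sL; have [p ps] := set0Pn _ (simplex_neq0 sL).
apply: (imset_simplex sL (supp_simplex (y p (time k)))) => q qs.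
exact: peak_self sL ps qs.
Qed.

Lemma contiguous_of_paths : contiguous N.+2 f g.
Proof.
(* The sequence is [f], then [peak 0] to [peak N], then [g], hence [N + 2] contiguity steps. *)
pose h j : smap L K :=
  if j is k.+1 then if (k <= N)%N then SMap (@peak_subproof k) else g else f.
exists h; split.
- by [].
- by rewrite /h ltnn.
case=> // k kN s sL; rewrite [k.+1.-1]/=.
have [p ps] := set0Pn _ (simplex_neq0 sL).
case: k kN => [|k] /= kN.
  have [t tK st] := y_start sL.
  apply: (imset2_simplex sL tK) => q qs; first by have [] := st _ qs.
  have [_ /fintype.subsetP] := st _ qs; apply; rewrite -time_start.
  exact: (peak_self _ sL qs qs).
rewrite !ltnS in kN; rewrite kN.
case: ifPn => [kN'|]; last rewrite -ltnNge => Nk.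
  (* For one fixed vertex [p] of [s], the support of [y p (time k)] contains the peaks of all
     vertices of [s] at both times. *)
  apply: (imset2_simplex sL (supp_simplex (y p (time k)))) => q qs.
    exact: peak_self sL ps qs.
  by apply: peak_supp sL ps qs _; rewrite distrC; exact: time_step.
have -> : k = N by apply/eqP; rewrite eqn_leq kN -ltnS Nk.
have [t tK st] := y_end sL.
apply: (imset2_simplex sL tK) => q qs; last by have [] := st _ qs.
have [_ /fintype.subsetP] := st _ qs; apply; rewrite -time_end.
exact: (peak_self _ sL qs qs).
Qed.

End ContiguousOfPaths.

Variable K : ordered_complex.
Variable iota : forall b : nat, smap (Sd (SdP K b)) (SdP K b).
Hypothesis iota_mem : forall b (F : Sd (SdP K b)), iota b F \in val F.

Local Notation X := (realization R K).

Lemma SC_cover_of_TC_cover n : TC_cover R X n ->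
  (\forall b \near \oo, \forall c \near \oo, SC_cover iota b c n)%classic.
Proof.
move=> [U [U_open U_cover U_section]].
pose sigma i := projT1 (cid (U_section i)).
have sigma_cont i : continuous (sigma i).
  by rewrite /sigma; case: cid => ? [].
have sigma_ends i u : path_ends (sigma i u) = val u.
  by rewrite /sigma; case: cid => ? [].
pose e : R := #|K|.+1%:R^-1.
have e0 : 0 < e by rewrite invr_gt0 ltr0n.
have e20 : 0 < e / 2 by lra.
have e40 : 0 < e / 2 / 2 by lra.
(* Members of [Q] lie in one [U i] over which the plan varies by less than [e / 2] at all times;
   [tube] with radius [e / 4] supplies one around each point. *)
pose Q (A : set (X * X)) := exists2 i, (A `<=` U i)%classic &
  forall u v : set_type (U i), A (val u) -> A (val v) ->
    forall t, close (e / 2) (sigma i u t) (sigma i v t).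
have [z|d d0 dQ] := @lebesgue_number R K K Q.
  have [i _ Uz] : (\bigcup_i U i)%classic z by rewrite U_cover.
  pose u0 : set_type (U i) := SigSub (mem_set Uz).
  have [_ [[W oW <-] Wz WA]] := @tube _ _ _ (sigma i) u0 _ (sigma_cont i) e40.
  exists (W `&` U i)%classic.
    by apply: open_nbhs_nbhs; split; [apply: openI; [|exact: U_open]|split].
  exists i => [y []//|u v [Wu _] [Wv _] t]; rewrite [e / 2]splitr.
  by apply: closeD (close_sym (WA u Wu t)) (WA v Wv t).
have mesh_lt : (\forall b \near \oo, (1 - #|SdP K 0|.+1%:R^-1 : R) ^+ b < d)%classic.
  by apply: (cvgr_lt _ (@mesh_cvg0 R K)).
near=> b.
have [loc1 [loc1_carried loc1_pi loc1_mesh]] :=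
  @locations R K iota iota_mem (sproj1 K K) b.
have [loc2 [loc2_carried loc2_pi loc2_mesh]] :=
  @locations R K iota iota_mem (sproj2 K K) b.
have mesh_b : (1 - #|SdP K 0|.+1%:R^-1 : R) ^+ b < d by near: b.
pose z p : X * X := (loc1 p, loc2 p).
(* The condition is inherited by faces, so it cuts out a subcomplex; its second half will provide
   the hypothesis [y_close]. *)
pose good i (s : {set SdP K b}) := (forall p, p \in s -> U i (z p)) /\
  forall u v : set_type (U i), (exists2 p, p \in s & z p = val u) ->
    (exists2 p, p \in s & z p = val v) ->
    forall t, close (e / 2) (sigma i u t) (sigma i v t).
pose Js i := [set s in simplex (SdP K b) | `[< good i s >]].
have Js_simplex i : Js i \subset simplex (SdP K b).
  by apply/fintype.subsetP => s; rewrite inE => /andP[].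
have Js_sub i (s t : {set SdP K b}) :
    s \in Js i -> t \subset s -> t != finset.set0 -> t \in Js i.
  rewrite !inE => /andP[sP /asboolP[sU su]] ts t0.
  rewrite (simplex_sub sP ts t0) /=; move/fintype.subsetP in ts.
  apply/asboolP; split=> [p /ts/sU//|u v [p /ts ps pu] [q /ts qs qv]].
  by apply: su; [exists p|exists q].
pose J i := Subcomplex (Js_simplex i) (Js_sub i).
have J_cover s : s \in simplex (SdP K b) -> exists i, s \in sub_simplex (J i).
  move=> sP; have [p ps] := set0Pn _ (simplex_neq0 sP).
  have [A [i AU Aclose] zA] := dQ (z p).
  have sA q : q \in s -> A (z q).
    move=> qs; apply: zA => v /=; apply: le_lt_trans mesh_b.
      exact: loc1_mesh sP _ _ ps qs v.
    exact: loc2_mesh sP _ _ ps qs v.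
  exists i; rewrite inE sP; apply/asboolP; split=> [q /sA/AU//|].
  by move=> u v [q /sA + qu] [r /sA + rv]; rewrite qu rv; exact: Aclose.
(* There are finitely many pairs [(i, p)], hence a common modulus; where [z p] is outside [U i] the
   condition is vacuous. *)
have modulus : (\forall m \near \oo, forall (i : 'I_n) (p : SdP K b),
    forall u : set_type (U i), z p = val u ->
    forall s t : unit_interval R, `|val s - val t| < m.+1%:R^-1 ->
      close (e / 2) (sigma i u s) (sigma i u t))%classic.
  apply: filter_forall => i; apply: filter_forall => p.
  have [Uzp|nUzp] := pselect (U i (z p)); last first.
    by apply: nearW => m u zu; case: nUzp; rewrite zu; exact: set_mem (valP u).
  have := @path_modulus R K (sigma i (SigSub (mem_set Uzp))) _ (@cts_fun _ _ _) e20.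
  apply: filterS => m mP u zu.
  by have -> : u = SigSub (mem_set Uzp) by apply/val_inj; rewrite -zu.
have [m0 _ m0P] := modulus.
(* [contiguous_of_paths] yields [m + 4] steps. Taking [m = c - 4] treats every large [c] directly,
   without comparing different values of [c]. *)
exists m0.+4 => // c /= cm0; exists J; split=> // i.
have /m0P : (m0 <= c - 4)%N by lia.
set m := (c - 4)%N => mP.
have -> : c = m.+4 by rewrite /m; lia.
have zJ (p : complex_of_subcomplex (J i)) : U i (z (val p)).
  have := valP p; rewrite /= inE => /andP[_ /asboolP[pU _]].
  by apply: pU; rewrite inE.
pose u p : set_type (U i) := SigSub (mem_set (zJ p)).
have [start_u end_u] :
    (forall p, sigma i (u p) (SigSub (unit_interval0 R)) = loc1 (val p)) /\
    (forall p, sigma i (u p) (SigSub (unit_interval1 R)) = loc2 (val p)).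
  by split=> p; have := sigma_ends i (u p) => -[].
have J_simplex (s : {set complex_of_subcomplex (J i)}) :
    s \in simplex (complex_of_subcomplex (J i)) -> val @: s \in simplex (SdP K b).
  by rewrite inE => /(fintype.subsetP (Js_simplex i)).
apply: (@contiguous_of_paths _ _ _ _ m (fun p => sigma i (u p))).
- move=> s /J_simplex/loc1_carried[t tK st]; exists t => // q qs.
  have qt := st _ (imset_f val qs); rewrite start_u; split=> //.
  exact: (fintype.subsetP qt _ (loc1_pi _)).
- move=> s /J_simplex/loc2_carried[t tK st]; exists t => // q qs.
  have qt := st _ (imset_f val qs); rewrite end_u; split=> //.
  exact: (fintype.subsetP qt _ (loc2_pi _)).
- move=> s; rewrite inE => sJ p q ps qs t; rewrite -/e.
  move: sJ; rewrite inE => /andP[_ /asboolP[_]]; apply.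
    by exists (val p) => //; exact: imset_f.
  by exists (val q) => //; exact: imset_f.
- by move=> p s t; exact: mP.
Unshelve. all: by end_near. Qed.

End ToSimplicial.

(** * Comparison of the two minima *)

Lemma least_minus1_min (P : nat -> Prop) n :
  P n -> (forall k, P k -> (n <= k)%N) -> least_minus1 P = (n%:Z - 1)%:E.
Proof.
move=> Pn nP; rewrite /least_minus1; case: pselect => [exP|[]]; last first.
  by exists n; apply/asboolP.
case: ex_minnP => m /asboolP Pm mP; congr (_ - _)%:E; congr Posz.
by apply/eqP; rewrite eqn_leq nP// mP//; apply/asboolP.
Qed.

Lemma least_minus1_none (P : nat -> Prop) :
  (forall k, ~ P k) -> least_minus1 P = +oo%E.
Proof.
move=> nP; rewrite /least_minus1; case: pselect => [exP|//].
by have [k /asboolP/nP] := exP.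
Qed.

Theorem theorem2p6 (R : realType) (K : ordered_complex)
  (iota : forall b : nat, smap (Sd (SdP K b)) (SdP K b))
  (iota_approx : forall b : nat,
     approximates (iota b) (@sd_homeo R (SdP K b))) :
  SC iota = TC R (realization R K).
Proof.
have iota_mem b (F : Sd (SdP K b)) : iota b F \in val F.
  exact: approximates_sd_homeo (iota_approx b) F.
have SC_TC b c n := @TC_cover_of_SC_cover R K iota iota_mem b c n.
have [[n Pn]|nTC] := pselect (exists n, TC_cover R (realization R K) n).
  have exP : exists n, `[< TC_cover R (realization R K) n >].
    by exists n; apply/asboolP.
  have [k /asboolP TCk k_min] := ex_minnP exP.
  have TC_min j : TC_cover R (realization R K) j -> (k <= j)%N.
    by move=> TCj; apply: k_min; apply/asboolP.
  rewrite /TC (least_minus1_min TCk TC_min).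
  (* By [SC_TC], [k] is a lower bound at every [b] and [c]; it is attained for large [b] and then
     large [c], so both stable values are [k - 1]. *)
  apply: stable_valueP.
  apply: filterS (SC_cover_of_TC_cover iota_mem TCk) => b bP.
  apply: stable_valueP; apply: filterS bP => c cP.
  by apply: least_minus1_min => // j /SC_TC/TC_min.
(* Without a finite motion planning cover there is no simplicial cover at any [b] and [c], so both
   sides are infinite. *)
have TCoo k : ~ TC_cover R (realization R K) k by move=> TCk; apply: nTC; exists k.
rewrite /TC least_minus1_none//.
apply: stable_valueP; apply: nearW => b; apply: stable_valueP; apply: nearW => c.
by apply: least_minus1_none => k /SC_TC/TCoo.
Qed.
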